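(* Let $n$ take values only in an infinite set of odd square-free integers greater than $1$ such that \[ \frac{n^{1/3}}{p_n}\to 0 \quad\text{as } n\to\infty, \] where $p_n$ is the smallest prime factor of $n$, and let $r$ be real. Let $J(z)=\sum_{j=1}^{n-1}\left(\frac{j}{n}\right)z^j$ be the character polynomial of degree $n-1$. Then \[ \lim_{n\to\infty}\,\max_{V\in\mathcal{V}_n}\,F(J_r+V_r)=\lim_{n\to\infty}\,\min_{V\in\mathcal{V}_n}\,F(J_r+V_r)=f(r). \]
   Context: For real $\alpha\ge1$ and $A\in\mathbb{C}[z]$, $\|A\|_\alpha=\left(\frac{1}{2\pi}\int_0^{2\pi}|A(e^{i\theta})|^\alpha d\theta\right)^{1/\alpha}$. The merit factor of $A$ is $F(A)=\frac{\|A\|_2^4}{\|A\|_4^4-\|A\|_2^4}$. For a polynomial $A$ of degree at most $n-1$ and real $r$, the rotation is $A_r(z)=z^{-\lfloor nr\rfloor}A(z)\bmod (z^n-1)$. $\left(\frac{\cdot}{n}\right)$ denotes the Jacobi symbol. $\mathcal{V}_n$ is the set of polynomials $\sum_{j=0}^{n-1}v_jz^j$ with $v_j\in\{0,-1,+1\}$ and $v_j=0$ if and only if $\gcd(j,n)=1$. The function $f$ is $1$-periodic with $f(r)=\dfrac{1}{\frac16+8\left(|r|-\frac14\right)^2}$ for $-\frac12<r\le\frac12$. *)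

(* Defs.v *)
From Stdlib Require Import Reals ZArith List Arith.
From Coquelicot Require Import Coquelicot.
From mathcomp Require prime.
Import ListNotations.
Open Scope R_scope.

Definition legendre (a p : nat) : Z :=
  if Nat.eqb (a mod p) 0 then 0%Z
  else if existsb (fun x => Nat.eqb ((x * x) mod p) (a mod p)) (seq 0 p)
       then 1%Z else (-1)%Z.

Definition jacobi (a n : nat) : Z :=
  fold_right (fun p acc => (legendre a p ^ Z.of_nat (prime.logn p n) * acc)%Z)
             1%Z (prime.primes n).

Definition smallest_prime_factor (n : nat) : nat := prime.pdiv n.

Definition squarefree (n : nat) : Prop :=
  forall d : nat, Nat.divide (d * d) n -> d = 1%nat.

(* A polynomial of degree at most N-1 is represented by its coefficient
   function a : nat -> C, only the coefficients a 0, ..., a (N-1) being used. *)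
Definition peval (N : nat) (a : nat -> C) (z : C) : C :=
  fold_right Cplus (RtoC 0) (map (fun j => Cmult (a j) (Cpow z j)) (seq 0 N)).

Definition expi (t : R) : C := (cos t, sin t).

Definition rpow (x a : R) : R :=
  if Rlt_dec 0 x then Rpower x a else 0.

Definition lnorm (N : nat) (alpha : R) (a : nat -> C) : R :=
  rpow (/ (2 * PI) * RInt (fun t => rpow (Cmod (peval N a (expi t))) alpha) 0 (2 * PI))
       (/ alpha).

Definition merit (N : nat) (a : nat -> C) : R :=
  (lnorm N 2 a) ^ 4 / ((lnorm N 4 a) ^ 4 - (lnorm N 2 a) ^ 4).

(* rotation A_r(z) = z^{-floor(n r)} A(z) mod (z^n - 1): the coefficient of z^j
   (0 <= j < n) is a_{(j + floor(n r)) mod n}.  Int_part = floor. *)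
Definition rot (n : nat) (r : R) (a : nat -> C) : nat -> C :=
  fun j => if Nat.ltb j n then
             a (Z.to_nat ((Z.of_nat j + Int_part (INR n * r)) mod Z.of_nat n)%Z)
           else RtoC 0.

Definition padd (a b : nat -> C) : nat -> C := fun j => Cplus (a j) (b j).

Definition charpoly (n : nat) : nat -> C :=
  fun j => if andb (Nat.leb 1 j) (Nat.ltb j n) then RtoC (IZR (jacobi j n)) else RtoC 0.

Fixpoint tern_vecs (k : nat) : list (list Z) :=
  match k with
  | O => [nil]
  | S k' => flat_map (fun s => [((-1)%Z :: s); (0%Z :: s); (1%Z :: s)]) (tern_vecs k')
  end.

Definition Vn_cond (n : nat) (v : list Z) : bool :=
  forallb (fun j => Bool.eqb (Z.eqb (nth j v 0%Z) 0%Z) (Nat.eqb (Nat.gcd j n) 1))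
          (seq 0 n).

Definition Vn (n : nat) : list (list Z) := filter (Vn_cond n) (tern_vecs n).

Definition vpoly (n : nat) (v : list Z) : nat -> C :=
  fun j => if Nat.ltb j n then RtoC (IZR (nth j v 0%Z)) else RtoC 0.

Definition merit_JV (n : nat) (r : R) (v : list Z) : R :=
  merit n (padd (rot n r (charpoly n)) (rot n r (vpoly n v))).

Fixpoint list_max (l : list R) : R :=
  match l with
  | nil => 0
  | [x] => x
  | x :: l' => Rmax x (list_max l')
  end.

Fixpoint list_min (l : list R) : R :=
  match l with
  | nil => 0
  | [x] => x
  | x :: l' => Rmin x (list_min l')
  end.

Definition maxF (n : nat) (r : R) : R := list_max (map (merit_JV n r) (Vn n)).
Definition minF (n : nat) (r : R) : R := list_min (map (merit_JV n r) (Vn n)).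

Definition f_base (r : R) : R := / (/ 6 + 8 * (Rabs r - / 4) ^ 2).

(* f is 1-periodic and equals f_base on (-1/2, 1/2]; the integer k below
   (= ceil(r - 1/2)) is the unique one with r - k in (-1/2, 1/2]. *)
Definition flim (r : R) : R := f_base (r - IZR (1 - up (/ 2 - r))).

Definition lim_along (S : nat -> Prop) (u : nat -> R) (l : R) : Prop :=
  forall eps : R, 0 < eps ->
    exists N : nat, forall n : nat, S n -> (N <= n)%nat -> Rabs (u n - l) < eps.

(* Main.v *)
Require Import Defs.
From Stdlib Require Import Reals ZArith Arith.
From Coquelicot Require Import Coquelicot.
From Stdlib Require Import Lra Lia List FunctionalExtensionality.
From mathcomp Require all_boot all_order all_algebra all_fingroup all_solvable
  all_field Rstruct zify ring lra.
Open Scope R_scope.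

(* The hypothesis forces [n] to be eventually a prime or a product of two primes,
   and the perturbation [V] to have [o(n^(2/3))] nonzero coefficients; since
   [||V||_4^4] counts additive quadruples in the support, it is [o(n^2)], so only
   [||J_r||_4^4 = sum_(a+b=c+d) g a g b g c g d] with [g a = (a+[nr] / n)] matters.

   For [0 <= a, b, c, d < n] the condition [a+b = c+d] is [a+b = c+d mod n] weighted
   by [1 - ((a+b-c-d)/n)^2]. Expanding the square, every term involves at most two of
   the variables, and the other two can be summed out exactly: this gives the
   periodic autocorrelation of the Jacobi symbol, a Ramanujan sum. Its main part
   [n * [n | u]] yields the limit; the remaining divisors contribute weighted
   character sums [sum_t (s+dt) chi(s+dt)], which are negligible because averaging
   over shifts and Cauchy-Schwarz only require small correlations of [chi]. No Weil
   bound is needed. *)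

(** * Norms as sums over additive quadruples *)

(** The cube in the hypothesis serves twice. A third prime factor would force [n >= p^3]; and the
    support of [V] has at most [2n/p] elements, with cube [8n^3/p^3], which is [o(n^2)] as soon as
    [n/p^3 -> 0]. The signs of [V] are arbitrary, so they can enter only through absolute values;
    the resulting bounds are uniform in [V], and therefore the maximum and the minimum share one
    limit.

    The supports of [J] and [V] are complementary, so every coefficient of [J+V] is 1 or -1 and
    [||J+V||_2^4 = n^2] exactly. It remains to show that the fourth moment divided by [n^2] tends to
    [1 + 1/f(r)].

    The rotation enters through the reflection [a -> kappa - a] with [kappa = -2[nr]] modulo [n],
    under which the rotated symbol is even or odd. Lifted to [[0, n)], the diagonals [c = a] and
    [b = kappa - a] produce [5/3 - 2x(1-x)] with [x = kappa/n].

    The character sums carry a relative error of order [1/M + M^2/p]: [M] is fixed large first, then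
    [p] grows. *)

Fixpoint rsum (N : nat) (f : nat -> R) : R :=
  match N with O => 0 | S k => rsum k f + f k end.

Lemma rsum_ext N f g : (forall k, (k < N)%nat -> f k = g k) -> rsum N f = rsum N g.
Proof.
  induction N as [|N IH]; intros E; simpl; [reflexivity|].
  rewrite IH, E by auto; reflexivity.
Qed.

Lemma rsum_plus N f g : rsum N (fun k => f k + g k) = rsum N f + rsum N g.
Proof. induction N as [|N IH]; simpl; rewrite ?IH; ring. Qed.

Lemma rsum_scal N c f : rsum N (fun k => c * f k) = c * rsum N f.
Proof. induction N as [|N IH]; simpl; rewrite ?IH; ring. Qed.

Lemma rsum_zero N : rsum N (fun _ => 0) = 0.
Proof. induction N as [|N IH]; simpl; rewrite ?IH; ring. Qed.

Lemma rsum_exchange N M (f : nat -> nat -> R) :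
  rsum N (fun i => rsum M (fun j => f i j)) = rsum M (fun j => rsum N (fun i => f i j)).
Proof.
  induction N as [|N IH]; simpl.
  - now rewrite rsum_zero.
  - now rewrite IH, rsum_plus.
Qed.

Lemma rsum_prod N f g : rsum N f * rsum N g = rsum N (fun j => rsum N (fun k => f j * g k)).
Proof.
  rewrite Rmult_comm, <- rsum_scal; apply rsum_ext; intros j _.
  now rewrite rsum_scal, Rmult_comm.
Qed.

Lemma is_RInt_rsum N (f : nat -> R -> R) (v : nat -> R) a b :
  (forall k, is_RInt (f k) a b (v k)) ->
  is_RInt (fun t => rsum N (fun k => f k t)) a b (rsum N v).
Proof.
  intros H; induction N as [|N IH]; simpl.
  - pose proof (is_RInt_const a b (0 : R)) as H0.
    change (scal (b - a) 0) with ((b - a) * 0) in H0; now rewrite Rmult_0_r in H0.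
  - apply (is_RInt_plus (V := R_NormedModule)); auto.
Qed.

Lemma is_RInt_cos_int (w : Z) :
  is_RInt (fun t => cos (IZR w * t)) 0 (2 * PI) (if Z.eqb w 0 then 2 * PI else 0).
Proof.
  destruct (Z.eqb_spec w 0) as [->|Hw].
  - apply (is_RInt_ext (fun _ => 1)).
    + intros t _; now rewrite Rmult_0_l, cos_0.
    + pose proof (is_RInt_const 0 (2 * PI) (1 : R)) as H0.
      change (scal (2 * PI - 0) 1) with ((2 * PI - 0) * 1) in H0.
      now rewrite Rmult_1_r, Rminus_0_r in H0.
  - assert (Hw' : IZR w <> 0) by now apply IZR_neq in Hw.
    assert (Hs : sin (IZR w * (2 * PI)) = 0).
    { apply sin_eq_0_1; exists (2 * w)%Z; rewrite mult_IZR; ring. }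
    assert (H0 : is_RInt (fun t => cos (IZR w * t)) 0 (2 * PI)
       (minus (sin (IZR w * (2 * PI)) / IZR w) (sin (IZR w * 0) / IZR w))).
    { apply (is_RInt_derive (fun t => sin (IZR w * t) / IZR w)).
      - intros x _; auto_derive; [trivial|field; trivial].
      - intros x _; apply continuity_pt_filterlim; reg. }
    rewrite Hs, Rmult_0_r, sin_0, minus_eq_zero in H0; exact H0.
Qed.

Definition indic (b : bool) : R := if b then 1 else 0.

Lemma is_RInt_cos_diff (a b : nat) :
  is_RInt (fun t => cos ((INR a - INR b) * t)) 0 (2 * PI) (2 * PI * indic (Nat.eqb a b)).
Proof.
  apply (is_RInt_ext (fun t => cos (IZR (Z.of_nat a - Z.of_nat b) * t))).
  - intros t _; now rewrite minus_IZR, <- !INR_IZR_INZ.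
  - replace (2 * PI * indic (Nat.eqb a b))
      with (if Z.eqb (Z.of_nat a - Z.of_nat b) 0 then 2 * PI else 0).
    + apply is_RInt_cos_int.
    + unfold indic; destruct (Z.eqb_spec (Z.of_nat a - Z.of_nat b) 0), (Nat.eqb_spec a b);
        try ring; lia.
Qed.

(** Real coefficients allow [|A(e^(it))|^2] to be handled as a real cosine sum, with no complex
    integrals. *)
Definition re_part N (x : nat -> R) t := rsum N (fun j => x j * cos (INR j * t)).
Definition im_part N (x : nat -> R) t := rsum N (fun j => x j * sin (INR j * t)).
Definition sqmod N x t := re_part N x t ^ 2 + im_part N x t ^ 2.

Lemma sqmod_expand N x t :
  sqmod N x t = rsum N (fun j => rsum N (fun k => x j * x k * cos ((INR j - INR k) * t))).
Proof.
  unfold sqmod, re_part, im_part; simpl; rewrite !Rmult_1_r, !rsum_prod, <- rsum_plus.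
  apply rsum_ext; intros j _; rewrite <- rsum_plus; apply rsum_ext; intros k _.
  rewrite Rmult_minus_distr_r, cos_minus; ring.
Qed.

Definition energy N (x : nat -> R) := rsum N (fun j => x j ^ 2).

Lemma rsum_pick N f j : (j < N)%nat -> rsum N (fun k => f k * indic (Nat.eqb j k)) = f j.
Proof.
  induction N as [|N IH]; intros Hj; [lia|]; simpl.
  destruct (Nat.eqb_spec j N) as [->|Hne]; unfold indic at 2.
  - rewrite (rsum_ext _ _ (fun _ => 0)), rsum_zero; [ring|].
    intros k Hk; unfold indic; destruct (Nat.eqb_spec N k); [lia|ring].
  - rewrite IH by lia; ring.
Qed.

Lemma is_RInt_sqmod N x : is_RInt (sqmod N x) 0 (2 * PI) (2 * PI * energy N x).
Proof.
  apply (is_RInt_ext (fun t => rsum N (fun j => rsum N (fun k =>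
    x j * x k * cos ((INR j - INR k) * t))))).
  { intros t _; now rewrite sqmod_expand. }
  replace (2 * PI * energy N x) with
    (rsum N (fun j => rsum N (fun k => x j * x k * (2 * PI * indic (Nat.eqb j k))))).
  - apply is_RInt_rsum; intros j; apply is_RInt_rsum; intros k.
    apply (is_RInt_scal (V := R_NormedModule)), is_RInt_cos_diff.
  - unfold energy; rewrite <- rsum_scal; apply rsum_ext; intros j Hj.
    rewrite (rsum_ext _ _ (fun k => (2 * PI * x j * x k) * indic (Nat.eqb j k)))
      by (intros; ring).
    rewrite (rsum_pick N (fun k => 2 * PI * x j * x k)) by trivial; ring.
Qed.

(** This is [||A||_4^4]: in the mean of [|A|^4] only the frequencies with [a + b = c + d]
    survive. *)
Definition quad_energy N (x : nat -> R) :=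
  rsum N (fun a => rsum N (fun b => rsum N (fun c => rsum N (fun d =>
    indic (Nat.eqb (a + b) (c + d)) * (x a * x b * x c * x d))))).

Lemma is_RInt_sqmod_sq N x :
  is_RInt (fun t => sqmod N x t ^ 2) 0 (2 * PI) (2 * PI * quad_energy N x).
Proof.
  (* The product of the cosines of [(j-k)t] and [(l-m)t] is half a sum of two cosines, whose
     frequencies vanish when [j + m = k + l] and when [j + l = k + m]. *)
  set (term := fun j k l m t => x j * x k * x l * x m *
     (/ 2 * (cos ((INR (j + m) - INR (k + l)) * t) + cos ((INR (j + l) - INR (k + m)) * t)))).
  apply (is_RInt_ext (fun t => rsum N (fun j => rsum N (fun k =>
     rsum N (fun l => rsum N (fun m => term j k l m t)))))).
  { intros t _; simpl; rewrite Rmult_1_r, sqmod_expand, rsum_prod.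
    transitivity (rsum N (fun j => rsum N (fun l => rsum N (fun k => rsum N (fun m =>
      term j k l m t))))).
    { apply rsum_ext; intros j _; now rewrite rsum_exchange. }
    apply rsum_ext; intros j _; apply rsum_ext; intros l _.
    rewrite rsum_prod; apply rsum_ext; intros k _; apply rsum_ext; intros m _.
    unfold term; rewrite !plus_INR.
    replace ((INR j + INR m - (INR k + INR l)) * t)
      with ((INR j - INR k) * t - (INR l - INR m) * t) by ring.
    replace ((INR j + INR l - (INR k + INR m)) * t)
      with ((INR j - INR k) * t + (INR l - INR m) * t) by ring.
    rewrite cos_minus, cos_plus; field. }
  set (val := fun j k l m => x j * x k * x l * x m * (/ 2 *
     (2 * PI * indic (Nat.eqb (j + m) (k + l)) + 2 * PI * indic (Nat.eqb (j + l) (k + m))))).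
  replace (2 * PI * quad_energy N x) with
    (rsum N (fun j => rsum N (fun k => rsum N (fun l => rsum N (fun m => val j k l m))))).
  { repeat (apply is_RInt_rsum; intros ?); unfold term, val.
    apply (is_RInt_scal (V := R_NormedModule)), (is_RInt_scal (V := R_NormedModule)),
      (is_RInt_plus (V := R_NormedModule)); apply is_RInt_cos_diff. }
  (* Each of the two resonance conditions gives the same quadruple sum, up to the order of
     summation. *)
  set (q1 := fun j k l m => indic (Nat.eqb (j + m) (k + l)) * (x j * x m * x k * x l)).
  set (q2 := fun j k l m => indic (Nat.eqb (j + l) (k + m)) * (x j * x l * x k * x m)).
  assert (E1 : rsum N (fun j => rsum N (fun k => rsum N (fun l => rsum N (fun m => q1 j k l m))))
     = quad_energy N x).
  { apply rsum_ext; intros j _.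
    transitivity (rsum N (fun k => rsum N (fun m => rsum N (fun l => q1 j k l m)))).
    { apply rsum_ext; intros k _; now rewrite rsum_exchange. }
    now rewrite rsum_exchange. }
  assert (E2 : rsum N (fun j => rsum N (fun k => rsum N (fun l => rsum N (fun m => q2 j k l m))))
     = quad_energy N x).
  { apply rsum_ext; intros j _; now rewrite rsum_exchange. }
  transitivity (PI * quad_energy N x + PI * quad_energy N x); [|ring].
  rewrite <- E1 at 1; rewrite <- E2.
  rewrite <- !rsum_scal, <- rsum_plus; apply rsum_ext; intros j _.
  rewrite <- !rsum_scal, <- rsum_plus; apply rsum_ext; intros k _.
  rewrite <- !rsum_scal, <- rsum_plus; apply rsum_ext; intros l _.
  rewrite <- !rsum_scal, <- rsum_plus; apply rsum_ext; intros m _.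
  unfold val, q1, q2; field.
Qed.

Lemma Cpow_expi t j : Cpow (expi t) j = expi (INR j * t).
Proof.
  induction j as [|j IH].
  - unfold expi; simpl; rewrite Rmult_0_l, cos_0, sin_0; reflexivity.
  - rewrite S_INR; simpl Cpow; rewrite IH; unfold expi, Cmult; simpl.
    rewrite Rmult_plus_distr_r, Rmult_1_l, cos_plus, sin_plus; f_equal; ring.
Qed.

Lemma peval_real N x t :
  peval N (fun j => RtoC (x j)) (expi t) = (re_part N x t, im_part N x t).
Proof.
  unfold peval, re_part, im_part.
  assert (app : forall l (z : C), fold_right Cplus (RtoC 0) (l ++ (z :: nil)) =
     Cplus (fold_right Cplus (RtoC 0) l) z).
  { intros l z; induction l as [|y l IH]; simpl; [now rewrite Cplus_0_r, Cplus_0_l|].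
    now rewrite IH, Cplus_assoc. }
  induction N as [|N IH]; [reflexivity|].
  rewrite seq_S, map_app; simpl map; rewrite app, IH.
  rewrite Cpow_expi; unfold expi, Cplus, Cmult, RtoC; simpl; f_equal; ring.
Qed.

Lemma Cmod_sqmod N x t : Cmod (peval N (fun j => RtoC (x j)) (expi t)) ^ 2 = sqmod N x t.
Proof.
  rewrite peval_real; unfold Cmod; rewrite pow2_sqrt; [reflexivity|simpl; nra].
Qed.

(** At [x = 0] the default value 0 of [rpow] agrees with the power because the exponent is
    positive. *)
Lemma rpow_nat x n : (0 < n)%nat -> 0 <= x -> rpow x (INR n) = x ^ n.
Proof.
  intros Hn Hx; unfold rpow; destruct (Rlt_dec 0 x) as [H|H].
  - now apply Rpower_pow.
  - replace x with 0 by lra; now rewrite pow_i.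
Qed.

Lemma rpow_inv_pow x n : (0 < n)%nat -> 0 <= x -> rpow x (/ INR n) ^ n = x.
Proof.
  intros Hn Hx; unfold rpow; destruct (Rlt_dec 0 x) as [H|H].
  - rewrite <- Rpower_pow, Rpower_mult, Rinv_l, Rpower_1; trivial.
    + now apply not_0_INR; lia.
    + apply exp_pos.
  - replace x with 0 by lra; now rewrite pow_i.
Qed.

Lemma sqmod_pos N x t : 0 <= sqmod N x t.
Proof. unfold sqmod; nra. Qed.

Lemma lnorm_pow N x m v : (0 < m)%nat -> 0 <= v ->
  is_RInt (fun t => Cmod (peval N (fun j => RtoC (x j)) (expi t)) ^ m) 0 (2 * PI) (2 * PI * v) ->
  lnorm N (INR m) (fun j => RtoC (x j)) ^ m = v.
Proof.
  intros Hm Hv H; unfold lnorm.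
  assert (E : RInt (fun t => rpow (Cmod (peval N (fun j => RtoC (x j)) (expi t))) (INR m))
     0 (2 * PI) = 2 * PI * v).
  { apply is_RInt_unique; revert H; apply is_RInt_ext; intros t _.
    rewrite rpow_nat; trivial; apply Cmod_ge_0. }
  rewrite E; pose proof PI_RGT_0.
  replace (/ (2 * PI) * (2 * PI * v)) with v by (field; lra).
  now apply rpow_inv_pow.
Qed.

Lemma energy_pos N x : 0 <= energy N x.
Proof.
  unfold energy; induction N as [|N IH]; simpl in *; [lra|nra].
Qed.

(** The terms of the sum have both signs; positivity is visible only in the integral of a square. *)
Lemma quad_energy_pos N x : 0 <= quad_energy N x.
Proof.
  pose proof PI_RGT_0.
  assert (0 <= 2 * PI * quad_energy N x); [|nra].
  apply (is_RInt_ge_0 (fun t => sqmod N x t ^ 2) 0 (2 * PI)); [lra|apply is_RInt_sqmod_sq|].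
  intros t _; apply pow2_ge_0.
Qed.

Lemma lnorm2_pow4 N x : lnorm N 2 (fun j => RtoC (x j)) ^ 4 = energy N x ^ 2.
Proof.
  replace 2 with (INR 2) at 1 by (simpl; ring).
  change 4%nat with (2 * 2)%nat; rewrite pow_mult.
  rewrite (lnorm_pow N x 2 (energy N x)); auto using energy_pos.
  apply (is_RInt_ext (sqmod N x)).
  - intros t _; now rewrite Cmod_sqmod.
  - apply is_RInt_sqmod.
Qed.

Lemma lnorm4_pow4 N x : lnorm N 4 (fun j => RtoC (x j)) ^ 4 = quad_energy N x.
Proof.
  replace 4 with (INR 4) at 1 by (simpl; ring).
  apply lnorm_pow; auto using quad_energy_pos with arith.
  apply (is_RInt_ext (fun t => sqmod N x t ^ 2)).
  - intros t _; change 4%nat with (2 * 2)%nat; now rewrite pow_mult, Cmod_sqmod.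
  - apply is_RInt_sqmod_sq.
Qed.

Lemma merit_real N x : merit N (fun j => RtoC (x j)) =
  energy N x ^ 2 / (quad_energy N x - energy N x ^ 2).
Proof. unfold merit; now rewrite lnorm2_pow4, lnorm4_pow4. Qed.

(* Twice the weighted parallelogram inequality [(u+v)^2 <= (1+e)u^2+(1+1/e)v^2]. *)
Lemma sqmod_sq_perturb N x y e t : 0 < e ->
  sqmod N (fun j => x j + y j) t ^ 2 <=
  (1 + e) ^ 3 * sqmod N x t ^ 2 + (1 + / e) ^ 3 * sqmod N y t ^ 2.
Proof.
  intros He.
  assert (par : forall u v, (u + v) ^ 2 <= (1 + e) * u ^ 2 + (1 + / e) * v ^ 2).
  { intros u v; assert (0 <= / e * (e * u - v) ^ 2).
    { apply Rmult_le_pos; [left; now apply Rinv_0_lt_compat|apply pow2_ge_0]. }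
    replace (/ e * (e * u - v) ^ 2) with (e * u ^ 2 - 2 * u * v + / e * v ^ 2) in H
      by (field; lra). nra. }
  assert (He' : 0 < / e) by now apply Rinv_0_lt_compat.
  assert (L : sqmod N (fun j => x j + y j) t <= (1 + e) * sqmod N x t + (1 + / e) * sqmod N y t).
  { unfold sqmod.
    replace (re_part N (fun j => x j + y j) t) with (re_part N x t + re_part N y t)
      by (unfold re_part; rewrite <- rsum_plus; apply rsum_ext; intros; ring).
    replace (im_part N (fun j => x j + y j) t) with (im_part N x t + im_part N y t)
      by (unfold im_part; rewrite <- rsum_plus; apply rsum_ext; intros; ring).
    pose proof (par (re_part N x t) (re_part N y t)).
    pose proof (par (im_part N x t) (im_part N y t)). lra. }
  pose proof (sqmod_pos N (fun j => x j + y j) t).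
  apply Rle_trans with (((1 + e) * sqmod N x t + (1 + / e) * sqmod N y t) ^ 2).
  - now apply pow_incr.
  (* Second use of [par]: [(1+e)((1+e)X)^2 = (1+e)^3 X^2], whence the cubes. *)
  - eapply Rle_trans; [apply par|]; apply Req_le; ring.
Qed.

(** A substitute for Minkowski's inequality in [L^4] that is linear in the fourth moments and so
    involves no roots. Applied once to [J] perturbed by [V] and once to [J+V] perturbed by [-V], it
    bounds the change from both sides. *)
Lemma quad_energy_perturb N x y e : 0 < e ->
  quad_energy N (fun j => x j + y j) <=
  (1 + e) ^ 3 * quad_energy N x + (1 + / e) ^ 3 * quad_energy N y.
Proof.
  intros He; pose proof PI_RGT_0.
  apply Rmult_le_reg_l with (2 * PI); [lra|].
  replace (2 * PI * ((1 + e) ^ 3 * quad_energy N x + (1 + / e) ^ 3 * quad_energy N y))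
    with ((1 + e) ^ 3 * (2 * PI * quad_energy N x) +
      (1 + / e) ^ 3 * (2 * PI * quad_energy N y)) by ring.
  apply (is_RInt_le (fun t => sqmod N (fun j => x j + y j) t ^ 2)
     (fun t => (1 + e) ^ 3 * sqmod N x t ^ 2 + (1 + / e) ^ 3 * sqmod N y t ^ 2) 0 (2 * PI)).
  - lra.
  - apply is_RInt_sqmod_sq.
  - apply (is_RInt_plus (V := R_NormedModule));
      apply (is_RInt_scal (V := R_NormedModule)), is_RInt_sqmod_sq.
  - intros t _; now apply sqmod_sq_perturb.
Qed.

(** * Fourth moments of the Jacobi symbol *)

Module JacobiMoments.
Import all_boot all_order all_algebra all_fingroup all_solvable all_field.
Import Rstruct zify ring lra.
Import Order.TTheory GRing.Theory Num.Theory.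
Set Implicit Arguments. Unset Strict Implicit. Unset Printing Implicit Defensive.

(** * Sums of periodic sequences over periods and residue classes *)

Section PeriodicSums.
Local Open Scope ring_scope.
Variable F : realFieldType.
Implicit Types (n u : nat) (f : nat -> F).

Definition periodic n f := forall a, f (a + n)%N = f a.

Lemma periodicM n f k a : periodic n f -> f (a + k * n)%N = f a.
Proof.
move=> fP; elim: k => [|k IH]; first by rewrite mul0n addn0.
by rewrite mulSn addnCA addnC fP.
Qed.

Lemma periodic_mod n f a : periodic n f -> f (a %% n)%N = f a.
Proof. by move=> fP; rewrite {2}(divn_eq a n) addnC periodicM. Qed.

Lemma periodic_eqmod n f a b : periodic n f -> a = b %[mod n] -> f a = f b.
Proof. by move=> fP ab; rewrite -(periodic_mod a fP) ab periodic_mod. Qed.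

Lemma sum_periodic_shift n f u :
  periodic n f -> \sum_(a < n) f (a + u)%N = \sum_(a < n) f a.
Proof.
move=> fP; elim: u => [|u IH]; first by apply: eq_bigr => a _; rewrite addn0.
rewrite -{}IH; case: n fP => [|n] fP; first by rewrite !big_ord0.
rewrite big_ord_recr [RHS]big_ord_recl /= addrC; congr (_ + _).
  by rewrite add0n addnS -addSn addnC fP.
by apply: eq_bigr => a _; rewrite /bump /= add1n addSnnS.
Qed.

Lemma sum_eqmod_pick n f u : (0 < n)%N -> periodic n f ->
  \sum_(b < n) (b == u %[mod n])%N%:R * f b = f u.
Proof.
move=> n0 fP; rewrite (bigD1 (Ordinal (ltn_pmod u n0))) //=.
rewrite modn_mod eqxx mul1r periodic_mod // big1 ?addr0 // => b bu.
rewrite modn_small // (_ : (_ == _) = false) ?mul0r //.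
by apply/negbTE; apply: contra bu => /eqP bu; apply/eqP/val_inj.
Qed.

Lemma sum_pick n f u : (u < n)%N ->
  \sum_(b < n) (b == u :> nat)%:R * f b = f u.
Proof.
move=> un; rewrite (bigD1 (Ordinal un)) //= eqxx mul1r big1 ?addr0 // => b bu.
by rewrite (_ : (_ == _) = false) ?mul0r //; apply/negbTE.
Qed.

Lemma sum_mul_split d e f :
  \sum_(a < d * e) f a = \sum_(s < d) \sum_(t < e) f (s + d * t)%N.
Proof.
elim: e => [|e IH].
  by rewrite muln0 big_ord0 big1 // => s _; rewrite big_ord0.
under [RHS]eq_bigr do rewrite big_ord_recr.
rewrite big_split /= -IH mulnS addnC.
rewrite -(big_mkord xpredT) (big_cat_nat _ (n := d * e)) ?leq_addr //=.
rewrite big_mkord; congr (_ + _).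
rewrite -{1}[(d * e)%N]add0n big_addn addKn big_mkord.
by apply: eq_bigr.
Qed.

Lemma sum_residue_class d e f s : (0 < d)%N ->
  \sum_(a < d * e) (a == s %[mod d])%N%:R * f a
  = \sum_(t < e) f (s %% d + d * t)%N.
Proof.
move=> d0; have modE x t : (x + d * t = x %[mod d])%N by rewrite mulnC addnC modnMDl.
rewrite (sum_mul_split d e (fun a => (a == s %[mod d])%N%:R * f a)).
rewrite (bigD1 (Ordinal (ltn_pmod s d0))) //= [X in _ + X]big1 ?addr0.
  by apply: eq_bigr => t _; rewrite modE modn_mod eqxx mul1r.
move=> i is_; apply: big1 => t _.
rewrite modE modn_small // (_ : (_ == _) = false) ?mul0r //.
by apply/negbTE; apply: contra is_ => /eqP bu; apply/eqP/val_inj.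
Qed.

End PeriodicSums.

(** * Weighted sums of a sequence with small autocorrelations *)

Section Window.
Local Open Scope ring_scope.
Variable F : realFieldType.
Variables (e d s M p : nat) (h : nat -> F).
Hypotheses (M_gt0 : (0 < M)%N) (M2_le_p : (M ^ 2 <= p)%N) (p_le_e : (p <= e)%N).
Hypotheses (d_gt0 : (0 < d)%N) (s_lt_d : (s < d)%N).
Hypotheses (h_per : periodic e h) (h_le1 : forall t, `|h t| <= 1).
Hypothesis sum_h : \sum_(t < e) h t = 0.
Hypothesis corr_h : forall l, (0 < l < p)%N ->
  `|\sum_(t < e) h t * h (t + l)%N| <= 1.

(** In the application [h t] is the character at the point [s + d t] of a residue class modulo [d],
    and [w t] is that point itself, as an integer in [[0, n)]. [S l] keeps the weights and shifts
    only the character. *)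
Let w t : F := (s + d * t)%N%:R.
Let n := (d * e)%N.
Let S l : F := \sum_(t < e) w t * h (t + l)%N.

(* Abel summation: the boundary terms of the shift add up to the period. *)
Lemma weighted_sum_shift l : S l.+1 = S l + n%:R * h l.
Proof.
have hl : periodic e (fun t => h (t + l)%N) by move=> t; rewrite addnAC h_per.
have E0 : \sum_(t < e) h (t + l)%N = 0 by rewrite sum_periodic_shift.
pose G t : F := (w t - d%:R) * h (t + l)%N.
have SE : S l.+1 = \sum_(t < e) G t.+1.
  apply: eq_bigr => t _; rewrite /G addSnnS; congr (_ * _).
  by rewrite /w mulnS !natrD; ring.
have GE : \sum_(t < e) G t = S l.
  rewrite /G; under eq_bigr do rewrite mulrBl.
  by rewrite sumrB -mulr_sumr E0 mulr0 subr0.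
have tele : \sum_(t < e) (G t.+1 - G t) = G e - G 0%N.
  by rewrite -(telescope_sumr G (leq0n e)) big_mkord.
rewrite SE -GE; move: tele; rewrite sumrB => /(canRL (subrK _)) ->.
rewrite addrC; congr (_ + _); rewrite /G /w [(e + l)%N]addnC h_per muln0 addn0 add0n.
by rewrite -mulrBl /n natrD; congr (_ * _); ring.
Qed.

Lemma weighted_sum_shift_bound l : `|S l - S 0| <= l%:R * n%:R.
Proof.
elim: l => [|l IH]; first by rewrite subrr normr0 mul0r.
rewrite weighted_sum_shift addrAC -natr1 mulrDl mul1r.
apply: le_trans (ler_normD _ _) _; apply: lerD => //.
by rewrite normrM normr_nat ler_piMr ?ler0n ?h_le1.
Qed.

(** [L] is the number of shifts averaged over. Since [L <= p], any two of them differ by less than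
    [p], which is the range of lags covered by [corr_h]. A square makes its root, the gain in
    Cauchy-Schwarz, the integer [M]. *)
Let L := (M ^ 2)%N.
Let H t : F := \sum_(l < L) h (t + l)%N.

Lemma shifted_corr_bound (i j : 'I_L) : i != j ->
  `|\sum_(t < e) h (t + i)%N * h (t + j)%N| <= 1.
Proof.
wlog ij : i j / (i < j)%N => [hw|] neq.
  have := neq; rewrite -(inj_eq val_inj) neq_ltn => /orP[|] ij.
    exact: hw.
  under eq_bigr do rewrite mulrC.
  by apply: hw => //; rewrite eq_sym.
pose f t := h t * h (t + (j - i))%N.
have fP : periodic e f by move=> t; rewrite /f h_per addnAC h_per.
have -> : \sum_(t < e) h (t + i)%N * h (t + j)%N = \sum_(t < e) f t.
  rewrite -(sum_periodic_shift i fP); apply: eq_bigr => t _.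
  by rewrite /f; congr (_ * h _); have := ij; lia.
by apply: corr_h; have := ltn_ord j; have := M2_le_p; rewrite -/L; lia.
Qed.

(** Expanding the square gives correlations at lag [j - i]: a diagonal pair contributes at most [e],
    any other pair at most 1. The window sums thus have mean square about [L] instead of the trivial
    [L^2]. *)
Lemma window_energy : \sum_(t < e) H t ^+ 2 <= (L * e)%:R + (L ^ 2)%:R.
Proof.
have -> : \sum_(t < e) H t ^+ 2 =
    \sum_(i < L) \sum_(j < L) \sum_(t < e) h (t + i)%N * h (t + j)%N.
  under eq_bigr do rewrite expr2 /H big_distrlr /=.
  by rewrite exchange_big /=; apply: eq_bigr => i _; rewrite exchange_big.
have -> : (L * e)%:R + (L ^ 2)%:R =
    \sum_(i < L) \sum_(j < L) ((i == j)%:R * e%:R + 1) :> F.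
  rewrite (eq_bigr (fun=> e%:R + L%:R)) => [|i _].
    by rewrite sumr_const card_ord -[RHS]mulr_natl mulrDr -!natrM -mulnn.
  rewrite big_split /= sumr_const card_ord; congr (_ + _).
  rewrite (bigD1 i) //= eqxx mul1r big1 ?addr0 // => j ij.
  by rewrite eq_sym (negbTE ij) mul0r.
apply: ler_sum => i _; apply: ler_sum => j _.
case: (eqVneq i j) => [->|ij]; last first.
  by rewrite mul0r add0r; apply: le_trans (ler_norm _) (shifted_corr_bound ij).
rewrite mul1r; apply: (@le_trans _ _ e%:R); last by rewrite lerDl.
rewrite -[e in e%:R]card_ord -sumr_const; apply: ler_sum => t _.
rewrite -expr2 -[X in X <= _]ger0_norm ?sqr_ge0 // normrX.
by rewrite exprn_ile1.
Qed.

(** Averaging over [L] shifts changes [S 0] by at most [L n] and replaces [h] by the window sum [H].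
    By [window_energy] and Cauchy-Schwarz the averaged sum is about [n e sqrt L / L = n e / M], a
    saving of [M] over the trivial bound [n e]. *)
Lemma weighted_sum_bound :
  `|S 0| <= (n * e)%:R * (M%:R^-1 + 3 * M%:R ^+ 2 / p%:R).
Proof.
have M0 : 0 < M%:R :> F by rewrite ltr0n.
have L0 : 0 < L%:R :> F by rewrite ltr0n expn_gt0 M_gt0.
have LE : L%:R = M%:R ^+ 2 :> F by rewrite natrX.
have p0 : 0 < p%:R :> F by rewrite ltr0n (leq_trans _ M2_le_p) // expn_gt0 M_gt0.
have pe : p%:R <= e%:R :> F by rewrite ler_nat.
have e0 : 0 < e%:R :> F by lra.
have n0 : 0 < n%:R :> F by rewrite ltr0n muln_gt0 d_gt0 -(ltr0n F).
have shifts : `|L%:R * S 0 - \sum_(l < L) S l| <= L%:R * (L%:R * n%:R).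
  rewrite mulr_natl -[L in _ *+ L]card_ord -sumr_const -sumrB.
  apply: le_trans (ler_norm_sum _ _ _) _.
  rewrite mulr_natl -[L in _ *+ L]card_ord -sumr_const; apply: ler_sum => l _.
  rewrite distrC; apply: le_trans (weighted_sum_shift_bound l) _.
  by rewrite ler_pM2r // ler_nat ltnW.
have sumS : \sum_(l < L) S l = \sum_(t < e) w t * H t.
  by rewrite exchange_big /=; apply: eq_bigr => t _; rewrite mulr_sumr.
(* AM-GM with weight M/n balances the two energies. *)
have energy : `|\sum_(t < e) w t * H t| <=
    2^-1 * (M%:R / n%:R * (e%:R * n%:R ^+ 2) + n%:R / M%:R * (L%:R * e%:R + L%:R ^+ 2)).
  have wE : \sum_(t < e) w t ^+ 2 <= e%:R * n%:R ^+ 2.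
    rewrite mulr_natl -[e in _ *+ e]card_ord -sumr_const; apply: ler_sum => t _.
    rewrite lerXn2r ?nnegrE ?ler0n // ler_nat /n.
    by apply: leq_trans (_ : d * t.+1 <= _)%N; [rewrite mulnS leq_add2r ltnW | rewrite leq_pmul2l].
  have HE := window_energy; rewrite natrM natrX in HE.
  apply: le_trans (ler_norm_sum _ _ _) _.
  apply: (@le_trans _ _ (\sum_(t < e) 2^-1 * (M%:R / n%:R * w t ^+ 2 + n%:R / M%:R * H t ^+ 2))).
    apply: ler_sum => t _.
    have k0 : 0 < M%:R / n%:R :> F by rewrite divr_gt0.
    have kV : M%:R / n%:R * (n%:R / M%:R) = 1 :> F by field; rewrite !gt_eqF.
    move: k0 kV; set k := M%:R / n%:R; set k' := n%:R / M%:R => k0 kV.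
    have k'0 : 0 < k' by rewrite divr_gt0.
    have sq1 : 0 <= k' * (k * w t - H t) ^+ 2 by rewrite mulr_ge0 ?sqr_ge0 ?ltW.
    have sq2 : 0 <= k' * (k * w t + H t) ^+ 2 by rewrite mulr_ge0 ?sqr_ge0 ?ltW.
    have e1 : k' * (k * w t - H t) ^+ 2 =
        (k * k') * (k * w t ^+ 2 - 2 * (w t * H t)) + k' * H t ^+ 2 by ring.
    have e2 : k' * (k * w t + H t) ^+ 2 =
        (k * k') * (k * w t ^+ 2 + 2 * (w t * H t)) + k' * H t ^+ 2 by ring.
    by rewrite ler_norml; move: sq1 sq2; rewrite e1 e2 kV; lra.
  rewrite -mulr_sumr big_split /= -!mulr_sumr ler_pM2l ?invr_gt0 //.
  by apply: lerD; rewrite ler_pM2l // divr_gt0.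
rewrite -sumS in energy.
have : L%:R * `|S 0| <= L%:R * (L%:R * n%:R) +
    2^-1 * (M%:R / n%:R * (e%:R * n%:R ^+ 2) + n%:R / M%:R * (L%:R * e%:R + L%:R ^+ 2)).
  rewrite -[L%:R in X in X <= _]ger0_norm ?(ltW L0) // -normrM.
  rewrite -(subrK (\sum_(l < L) S l) (_ * S 0)).
  by apply: le_trans (ler_normD _ _) _; apply: lerD.
rewrite -ler_pdivlMl // => /le_trans; apply.
rewrite LE natrM.
have -> : (M%:R ^+ 2)^-1 * (M%:R ^+ 2 * (M%:R ^+ 2 * n%:R) +
    2^-1 * (M%:R / n%:R * (e%:R * n%:R ^+ 2) +
            n%:R / M%:R * (M%:R ^+ 2 * e%:R + M%:R ^+ 2 ^+ 2)))
    = n%:R * e%:R / M%:R + n%:R * (M%:R ^+ 2 + M%:R / 2) :> F.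
  by field; rewrite !gt_eqF.
(* Beyond [n e / M] there remains [n (M^2 + M/2)], which the term [3 M^2 n e / p] absorbs because
   [M >= 1] and [e >= p]. *)
have M1 : 1 <= M%:R :> F by rewrite ler1n.
have z1 : 1 <= e%:R / p%:R :> F by rewrite ler_pdivlMr // mul1r.
have -> : n%:R * e%:R * (M%:R^-1 + 3 * M%:R ^+ 2 / p%:R)
    = n%:R * e%:R / M%:R + n%:R * (3 * M%:R ^+ 2 * (e%:R / p%:R)) :> F.
  by field; rewrite !gt_eqF.
rewrite lerD2l ler_pM2l //.
have : M%:R ^+ 2 * 1 <= M%:R ^+ 2 * (e%:R / p%:R) :> F by rewrite ler_pM2l // exprn_gt0.
have : M%:R * 1 <= M%:R ^+ 2 :> F by rewrite expr2 ler_pM2l.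
have : 0 <= M%:R ^+ 2 :> F by rewrite sqr_ge0.
rewrite !mulr1 -mulrA; lra.
Qed.

End Window.

(** * Fourth moment of a rotated character with Ramanujan-type autocorrelation *)

Section FourthMoment.
Local Open Scope ring_scope.
Variable F : realFieldType.

Definition fourth_moment (n : nat) (x : nat -> F) : F :=
  \sum_(a < n) \sum_(b < n) \sum_(c < n) \sum_(d < n)
    (a + b == c + d)%N%:R * (x a * x b * x c * x d).

(** For entries in [[0, n)] a difference [a + b - c - d] divisible by [n] is [0], [n] or [-n]; the
    quadratic weight is 1 at the first value and vanishes at the other two. *)
Lemma additive_quadruple_indicator (n a b c d : nat) :
  (a < n)%N -> (b < n)%N -> (c < n)%N -> (d < n)%N ->
  (a + b == c + d)%N%:R = (a + b == c + d %[mod n])%N%:R *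
    (1 - n%:R^-2 * (a%:R + b%:R - c%:R - d%:R) ^+ 2) :> F.
Proof.
move=> an bn cn dn.
have n0 : n%:R != 0 :> F by rewrite pnatr_eq0; lia.
have [abcd|abcd] := eqVneq (a + b)%N (c + d)%N.
  have -> : a%:R + b%:R - c%:R - d%:R = 0 :> F.
    by rewrite -addrA -opprD -!natrD abcd subrr.
  by rewrite abcd eqxx expr0n /= mulr0 subr0 mulr1.
have [E|E] := eqVneq ((a + b) %% n)%N ((c + d) %% n)%N; last by rewrite mul0r.
have : (a + b = c + d + n \/ a + b + n = c + d)%N.
  have := divn_eq (a + b) n; have := divn_eq (c + d) n; rewrite {}E.
  have : ((a + b) %/ n < 2)%N by rewrite ltn_divLR; lia.
  have : ((c + d) %/ n < 2)%N by rewrite ltn_divLR; lia.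
  move: ((a + b) %/ n)%N ((c + d) %/ n)%N ((c + d) %% n)%N abcd.
  by move=> [|[|x]] [|[|y]] z; lia.
rewrite mul1r => abcd'.
have -> : (a%:R + b%:R - c%:R - d%:R) ^+ 2 = n%:R ^+ 2 :> F.
  have sq (x y z : nat) : (x = y + z)%N -> (x%:R - y%:R) ^+ 2 = z%:R ^+ 2 :> F.
    by move=> ->; rewrite natrD addrC addKr.
  rewrite -addrA -opprD -!natrD; case: abcd' => [/sq //|/esym/sq <-].
  by rewrite -sqrrN opprB.
by rewrite mulVf ?subrr // sqrf_eq0.
Qed.

Lemma dvdn_double_opp (n r : nat) : (r < n)%N ->
  (n %| (3 * n - 2 * r) %% n + 2 * r)%N.
Proof. by move=> rn; rewrite /dvdn modnDml subnK ?modnMl //; lia. Qed.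

(* The autocorrelation of a primitive quadratic character of square-free modulus
   [n] is the Ramanujan sum: [n * [n | u]] plus terms [sigma * d * [d | u]] over
   the proper divisors [d] of [n]. The list [Ls] holds the pairs [(d, sigma)], and
   [p] bounds the lags at which correlations along classes modulo [d] are small. *)
Record flat_character (n p : nat) (chi : nat -> F) (eps : F)
    (Ls : seq (nat * F)) : Prop := FlatCharacter {
  chi_per : periodic n chi;
  chi_sq : forall a, chi a ^+ 2 = (coprime a n)%:R;
  chi_opp : forall a b, (n %| a + b)%N -> chi a = eps * chi b;
  eps_sq : eps ^+ 2 = 1;
  corr_chi : forall u, \sum_(a < n) chi a * chi (a + u)%N =
    (n %| u)%N%:R * n%:R + \sum_(ds <- Ls) ds.2 * ds.1%:R * (ds.1 %| u)%N%:R;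
  size_Ls : (size Ls <= 3)%N;
  Ls_dvd : forall ds, ds \in Ls -> (ds.1 %| n)%N;
  Ls_norm : forall ds, ds \in Ls -> `|ds.2| <= 1;
  Ls_cofactor : forall ds, ds \in Ls -> (p <= n %/ ds.1)%N;
  Ls_sum : forall ds s, ds \in Ls ->
    \sum_(t < n %/ ds.1) chi (s + ds.1 * t)%N = 0;
  Ls_corr : forall ds s l, ds \in Ls -> (0 < l < p)%N ->
    `|\sum_(t < n %/ ds.1) chi (s + ds.1 * t)%N * chi (s + ds.1 * (t + l))%N| <= 1
}.

Variables (n p M R0 : nat) (chi : nat -> F) (eps : F) (Ls : seq (nat * F)).
Hypothesis chiF : flat_character n p chi eps Ls.
Hypothesis R0_lt_n : (R0 < n)%N.
Hypotheses (M_gt0 : (0 < M)%N) (M2_le_p : (M ^ 2 <= p)%N).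

Let n_gt0 : (0 < n)%N := leq_ltn_trans (leq0n R0) R0_lt_n.
Let chi_per := chi_per chiF.
Let chi_sq := chi_sq chiF.
Let chi_opp := chi_opp chiF.
Let eps_sq := eps_sq chiF.
Let corr_chi := corr_chi chiF.
Let size_Ls := size_Ls chiF.
Let Ls_dvd := Ls_dvd chiF.
Let Ls_norm := Ls_norm chiF.
Let Ls_cofactor := Ls_cofactor chiF.
Let Ls_sum := Ls_sum chiF.
Let Ls_corr := Ls_corr chiF.

Let g a : F := chi (a + R0)%N.
Let K (a b c d : nat) : F := (a + b == c + d %[mod n])%N%:R.
(** [kappa] represents [-2 R0] modulo [n]; the multiple [3 n] keeps the subtraction in [nat]. Then
    [kappa - a + R0] is opposite to [a + R0], so [g] at [k a], the reflection of [a] reduced to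
    [[0, n)], equals [eps * g a]. *)
Let kappa := ((3 * n - 2 * R0) %% n)%N.
Let k a := ((kappa + n - a) %% n)%N.
(** The relative error provided by [weighted_sum_bound]. *)
Let eta : F := M%:R^-1 + 3 * M%:R ^+ 2 / p%:R.

Let g_per : periodic n g.
Proof. by move=> a; rewrite /g addnAC chi_per. Qed.

Lemma chi_le1 a : `|chi a| <= 1.
Proof.
rewrite -(@expr_le1 _ 2) // -normrX chi_sq ger0_norm ?ler0n //.
by case: (coprime a n); rewrite ?ler01.
Qed.

Lemma eps_norm : `|eps| = 1.
Proof.
by apply/eqP; rewrite -(@pexpr_eq1 _ _ 2) // -normrX eps_sq normr1.
Qed.

Let kappa_opp : (n %| kappa + 2 * R0)%N := dvdn_double_opp R0_lt_n.

(** With [a] and [c] fixed, the congruence determines [b = d + (c - a)], and the sum over [d] is the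
    autocorrelation of [chi] at lag [c - a]. *)
Lemma difference_kernel a c : (a < n)%N -> (c < n)%N ->
  \sum_(b < n) \sum_(d < n) K a b c d * (g b * g d) =
  (a == c)%:R * n%:R +
  \sum_(ds <- Ls) ds.2 * ds.1%:R * (c == a %[mod ds.1])%N%:R.
Proof.
move=> an cn; rewrite exchange_big /=.
(* [c + (n - a)] represents [c - a] without truncation. *)
pose u := (c + (n - a))%N.
have Ksum (d : 'I_n) : \sum_(b < n) K a b c d * (g b * g d) = g d * g (d + u)%N.
  rewrite mulrC -(sum_eqmod_pick (d + u) n_gt0 g_per) big_distrl /=.
  apply: eq_bigr => b _; rewrite mulrA; congr (_%:R * _ * _).
  rewrite -(eqn_modDl a b) /u.
  have -> : (a + (d + (c + (n - a))) = c + d + n)%N by lia.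
  by rewrite modnDr.
rewrite (eq_bigr (fun d : 'I_n => g d * g (d + u)%N)) => [|d _]; last exact: Ksum.
pose f d := chi d * chi (d + u)%N.
have fP : periodic n f by move=> d; rewrite /f chi_per addnAC chi_per.
rewrite (eq_bigr (fun d : 'I_n => f (d + R0)%N)) => [|d _]; last first.
  by rewrite /f /g; congr (_ * chi _); lia.
have dvdE d0 : (d0 %| n)%N -> (d0 %| u)%N = (c == a %[mod d0])%N.
  move=> d0n; rewrite -(eqn_modDr (n - a)) subnKC ?(ltnW an) //.
  by rewrite (eqP d0n).
rewrite sum_periodic_shift // corr_chi dvdE // !modn_small // eq_sym.
by congr (_ + _); apply: eq_big_seq => ds /Ls_dvd dn; rewrite dvdE.
Qed.

(** With [a] and [b] fixed, [d = a + b - c] runs against [c]. The parity of [chi] turns [g d] into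
    [eps * chi (c + R0 + v)] with [v = kappa - a - b], and again an autocorrelation appears. *)
Lemma sum_kernel a b : (a < n)%N ->
  \sum_(c < n) \sum_(d < n) K a b c d * (g c * g d) =
  eps * ((b == kappa + n - a %[mod n])%N%:R * n%:R +
  \sum_(ds <- Ls) ds.2 * ds.1%:R * (b == kappa + n - a %[mod ds.1])%N%:R).
Proof.
move=> an.
(* [(b + 1) * n - b] represents [-b]; since [b] may exceed [n], a large multiple of [n] is added. *)
pose v := (kappa + n - a + ((b + 1) * n - b))%N.
have Ksum (c : 'I_n) :
    \sum_(d < n) K a b c d * (g c * g d) = eps * (g c * chi (c + R0 + v)%N).
  have cb : (c <= a + b + n)%N by have := ltn_ord c; lia.
  have -> : chi (c + R0 + v) = eps * g (a + b + n - c)%N.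
    apply: chi_opp.
    have bn : (b <= (b + 1) * n)%N by nia.
    have -> : (c + R0 + v + (a + b + n - c + R0) =
               kappa + 2 * R0 + ((b + 1) * n + n + n))%N by rewrite /v; lia.
    by rewrite dvdn_add ?kappa_opp // !dvdn_add // dvdn_mull.
  rewrite mulrCA [_ * (_ * g _)]mulrA -expr2 eps_sq mul1r.
  rewrite -(sum_eqmod_pick (a + b + n - c) n_gt0 g_per) mulr_sumr.
  apply: eq_bigr => d _; rewrite [RHS]mulrCA; congr (_%:R * _).
  rewrite -(eqn_modDl c d) subnKC // modnDr eq_sym.
  by [].
rewrite (eq_bigr (fun c : 'I_n => eps * (g c * chi (c + R0 + v)%N))); last first.
  by move=> c _; apply: Ksum.
rewrite -mulr_sumr; congr (_ * _).
pose f d := chi d * chi (d + v)%N.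
have fP : periodic n f by move=> d; rewrite /f chi_per addnAC chi_per.
have bn : (b <= (b + 1) * n)%N by nia.
have dvdE d0 : (d0 %| n)%N -> (d0 %| v)%N = (b == kappa + n - a %[mod d0])%N.
  move=> d0n; rewrite -(eqn_modDr ((b + 1) * n - b)) subnKC // -/v.
  by rewrite (eqP (dvdn_mull _ d0n)) eq_sym.
rewrite (sum_periodic_shift R0 fP) corr_chi dvdE //.
by congr (_ + _); apply: eq_big_seq => ds /Ls_dvd dn; rewrite dvdE.
Qed.

(** The quadruple sum over the congruence modulo [n] with an extra weight. The quadratic correction
    is a combination of weights in at most two variables, so the other two can be summed out. *)
Let T (phi : nat -> nat -> nat -> nat -> F) : F :=
  \sum_(a < n) \sum_(b < n) \sum_(c < n) \sum_(d < n)
    K a b c d * (g a * g b * g c * g d) * phi a b c d.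

(** This symmetry and the next two reduce the ten monomials of [(a + b - c - d)^2] to the three
    types [a^2], [a b] and [a c]. *)
Lemma T_swap_left phi : T phi = T (fun a b c d => phi b a c d).
Proof.
rewrite /T exchange_big; apply: eq_bigr => b _; apply: eq_bigr => a _.
apply: eq_bigr => c _; apply: eq_bigr => d _.
by rewrite /K addnC (mulrC (g a)).
Qed.

Lemma T_swap_right phi : T phi = T (fun a b c d => phi a b d c).
Proof.
rewrite /T; apply: eq_bigr => a _; apply: eq_bigr => b _.
rewrite exchange_big; apply: eq_bigr => d _; apply: eq_bigr => c _.
by rewrite /K (addnC c) (mulrAC (g a * g b)).
Qed.

Lemma T_swap_sides phi : T phi = T (fun a b c d => phi c d a b).
Proof.
rewrite /T.
transitivity (\sum_(a < n) \sum_(c < n) \sum_(b < n) \sum_(d < n)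
    K a b c d * (g a * g b * g c * g d) * phi a b c d).
  by apply: eq_bigr => a _; rewrite exchange_big.
rewrite exchange_big; apply: eq_bigr => c _.
transitivity (\sum_(a < n) \sum_(d < n) \sum_(b < n)
    K a b c d * (g a * g b * g c * g d) * phi a b c d).
  by apply: eq_bigr => a _; rewrite exchange_big.
rewrite exchange_big; apply: eq_bigr => d _; apply: eq_bigr => a _.
apply: eq_bigr => b _; congr (_ * _); rewrite /K eq_sym.
by congr (_ * _); ring.
Qed.

Lemma T_ac (phi : nat -> nat -> F) :
  T (fun a _ c _ => phi a c) =
  n%:R * (\sum_(a < n) g a ^+ 2 * phi a a) +
  \sum_(a < n) \sum_(ds <- Ls) ds.2 * ds.1%:R *
    \sum_(c < n) (c == a %[mod ds.1])%N%:R * (g a * g c * phi a c).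
Proof.
rewrite /T mulr_sumr -big_split; apply: eq_bigr => a _ /=.
rewrite exchange_big /=.
transitivity (\sum_(c < n) g a * g c * phi a c * ((a == c :> nat)%:R * n%:R +
  \sum_(ds <- Ls) ds.2 * ds.1%:R * (c == a %[mod ds.1])%N%:R)).
  apply: eq_bigr => c _; rewrite -(difference_kernel (ltn_ord a) (ltn_ord c)) mulr_sumr.
  apply: eq_bigr => b _; rewrite mulr_sumr; apply: eq_bigr => d _.
  by rewrite /K; ring.
under [LHS]eq_bigr do rewrite mulrDr.
rewrite big_split /=; congr (_ + _).
  rewrite -(sum_pick (fun c => n%:R * (g a * g c * phi a c)) (ltn_ord a)).
  by apply: eq_bigr => c _; rewrite (eq_sym (c : nat)); ring.
under [RHS]eq_bigr do rewrite mulr_sumr.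
rewrite exchange_big /=; apply: eq_bigr => c _.
by rewrite mulr_sumr; apply: eq_bigr => ds _; ring.
Qed.

Lemma T_ab (phi : nat -> nat -> F) :
  T (fun a b _ _ => phi a b) =
  n%:R * (\sum_(a < n) g a ^+ 2 * phi a (k a)) +
  eps * \sum_(a < n) \sum_(ds <- Ls) ds.2 * ds.1%:R *
    \sum_(b < n) (b == kappa + n - a %[mod ds.1])%N%:R * (g a * g b * phi a b).
Proof.
rewrite /T !mulr_sumr -big_split; apply: eq_bigr => a _ /=.
transitivity (\sum_(b < n) g a * g b * phi a b *
  (eps * ((b == kappa + n - a %[mod n])%N%:R * n%:R +
  \sum_(ds <- Ls) ds.2 * ds.1%:R * (b == kappa + n - a %[mod ds.1])%N%:R))).
  apply: eq_bigr => b _; rewrite -(sum_kernel b (ltn_ord a)) mulr_sumr.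
  apply: eq_bigr => c _; rewrite mulr_sumr; apply: eq_bigr => d _.
  by rewrite /K; ring.
under [LHS]eq_bigr do rewrite !mulrDr.
rewrite big_split /=; congr (_ + _).
  pose f b := eps * n%:R * (g a * g b * phi a (b %% n)%N).
  have fP : periodic n f by move=> b; rewrite /f g_per modnDr.
  transitivity (f (kappa + n - a)%N).
    rewrite -(sum_eqmod_pick _ n_gt0 fP); apply: eq_bigr => b _.
    by rewrite /f (modn_small (ltn_ord b)); ring.
  (* The sign from the reflection meets the sign from [sum_kernel], and [eps ^+ 2 = 1]: even and odd
     characters have the same main term. *)
  have gk : g (kappa + n - a) = eps * g a.
    apply: chi_opp; have an := ltn_ord a.
    have -> : (kappa + n - a + R0 + (a + R0) = kappa + 2 * R0 + n)%N by lia.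
    by rewrite dvdn_add // kappa_opp.
  rewrite /f gk -/(k a).
  transitivity (eps ^+ 2 * (n%:R * (g a ^+ 2 * phi a (k a)))); first by ring.
  by rewrite eps_sq mul1r.
under [X in _ * X]eq_bigr do rewrite mulr_sumr.
rewrite exchange_big /= mulr_sumr; apply: eq_bigr => b _.
by rewrite !mulr_sumr; apply: eq_bigr => ds _; ring.
Qed.

(** The residues congruent to [s] modulo [d] form a progression of length [n/d], along which the
    fields [Ls_sum] and [Ls_corr] supply the hypotheses of [weighted_sum_bound]. *)
Lemma class_sum_bound ds s : ds \in Ls ->
  `|\sum_(c < n) (c == s %[mod ds.1])%N%:R * (c%:R * g c)|
  <= (n * (n %/ ds.1))%:R * eta.
Proof.
move=> dsL; have dn := Ls_dvd dsL.
have nE : (n = ds.1 * (n %/ ds.1))%N by rewrite mulnC divnK.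
have d0 : (0 < ds.1)%N by exact: dvdn_gt0 dn.
have := sum_residue_class (n %/ ds.1) (fun c => c%:R * g c) s d0.
rewrite -nE => ->.
pose h t := g (s %% ds.1 + ds.1 * t)%N.
have hE t : h t = chi (s %% ds.1 + R0 + ds.1 * t)%N by rewrite /h /g addnAC.
rewrite (eq_bigr (fun t : 'I_(n %/ ds.1) =>
  (s %% ds.1 + ds.1 * t)%N%:R * h (t + 0)%N)); last by move=> t _; rewrite addn0.
have -> : (n * (n %/ ds.1) = ds.1 * (n %/ ds.1) * (n %/ ds.1))%N by rewrite -nE.
apply: weighted_sum_bound; rewrite ?Ls_cofactor ?ltn_pmod //.
- by move=> t; rewrite /h mulnDr -nE addnA g_per.
- by move=> t; apply: chi_le1.
- by under eq_bigr do rewrite hE; apply: Ls_sum.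
- by move=> l lp; under eq_bigr do rewrite !hE; apply: Ls_corr.
Qed.

(** For each [a] and each divisor [d] the factor [d] cancels against the class length [n/d], leaving
    [n^3 eta]; there are [n] values of [a] and at most three divisors. *)
Lemma error_bound (u : nat -> nat) :
  `|\sum_(a < n) \sum_(ds <- Ls) ds.2 * ds.1%:R *
    \sum_(c < n) (c == u a %[mod ds.1])%N%:R * (g a * g c * (a%:R * c%:R))|
  <= 3 * n%:R ^+ 4 * eta.
Proof.
have eta0 : 0 <= eta.
  by rewrite addr_ge0 ?invr_ge0 ?ler0n // divr_ge0 ?ler0n // mulr_ge0 // sqr_ge0.
apply: le_trans (ler_norm_sum _ _ _) _.
have step (a : 'I_n) : true -> `|\sum_(ds <- Ls) ds.2 * ds.1%:R *
    \sum_(c < n) (c == u a %[mod ds.1])%N%:R * (g a * g c * (a%:R * c%:R))|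
    <= 3 * n%:R ^+ 3 * eta.
  move=> _; apply: le_trans (ler_norm_sum _ _ _) _.
  apply: (@le_trans _ _ (\sum_(ds <- Ls) n%:R ^+ 3 * eta)); last first.
    rewrite big_const_seq count_predT iter_addr addr0 -[leLHS]mulr_natl -mulrA.
    by rewrite ler_wpM2r ?mulr_ge0 ?exprn_ge0 ?ler0n // ler_nat.
  rewrite big_seq [leRHS]big_seq; apply: ler_sum => ds dsL.
  rewrite (eq_bigr (fun c : 'I_n => g a * a%:R *
     ((c == u a %[mod ds.1])%N%:R * (c%:R * g c)))); last by move=> c _; ring.
  rewrite -mulr_sumr !normrM normr_nat [`|a%:R|]normr_nat.
  have B := class_sum_bound (u a) dsL.
  have nE : n%:R = ds.1%:R * (n %/ ds.1)%:R :> F.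
    by rewrite -natrM mulnC divnK // Ls_dvd.
  have -> : n%:R ^+ 3 * eta = ds.1%:R * (n%:R * ((n * (n %/ ds.1))%:R * eta)).
    by rewrite natrM nE; ring.
  apply: ler_pM => //; first by rewrite mulr_ge0 // ler0n.
    by rewrite !mulr_ge0 // ler0n.
    by rewrite ler_piMl ?ler0n ?Ls_norm.
  apply: ler_pM => //; first by rewrite mulr_ge0 // ler0n.
  rewrite -[n%:R]mul1r; apply: ler_pM => //; rewrite ?ler0n ?chi_le1 //.
  by rewrite ler_nat ltnW.
apply: le_trans (ler_sum _ step) _.
rewrite sumr_const card_ord -[leLHS]mulr_natl.
by rewrite le_eqVlt; apply/orP; left; apply/eqP; ring.
Qed.

Lemma T_ext phi psi : (forall a b c d, phi a b c d = psi a b c d) -> T phi = T psi.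
Proof.
move=> E; apply: eq_bigr => a _; apply: eq_bigr => b _; apply: eq_bigr => c _.
by apply: eq_bigr => d _; rewrite E.
Qed.

Lemma T_add phi psi :
  T (fun a b c d => phi a b c d + psi a b c d) = T phi + T psi.
Proof.
rewrite /T -big_split; apply: eq_bigr => a _; rewrite -big_split.
apply: eq_bigr => b _; rewrite -big_split; apply: eq_bigr => c _.
by rewrite -big_split; apply: eq_bigr => d _; rewrite mulrDr.
Qed.

Lemma T_scale z phi : T (fun a b c d => z * phi a b c d) = z * T phi.
Proof.
rewrite /T mulr_sumr; apply: eq_bigr => a _; rewrite mulr_sumr.
apply: eq_bigr => b _; rewrite mulr_sumr; apply: eq_bigr => c _.
by rewrite mulr_sumr; apply: eq_bigr => d _; rewrite mulrCA.
Qed.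

Let Taa := T (fun a _ _ _ => a%:R ^+ 2).
Let Tab := T (fun a b _ _ => a%:R * b%:R).
Let Tac := T (fun a _ c _ => a%:R * c%:R).

Lemma T_square_expansion :
  T (fun a b c d => (a%:R + b%:R - c%:R - d%:R) ^+ 2)
  = 4 * Taa + 4 * Tab - 8 * Tac.
Proof.
pose sq (x : nat) : F := x%:R ^+ 2.
rewrite (@T_ext _ (fun a b c d => sq a + (sq b + (sq c + (sq d +
  (2 * (a%:R * b%:R) + (2 * (c%:R * d%:R) + ((-2) * (a%:R * c%:R) +
  ((-2) * (a%:R * d%:R) + ((-2) * (b%:R * c%:R) + (-2) * (b%:R * d%:R))))))))))); last first.
  by move=> a b c d; rewrite /sq; ring.
rewrite !T_add !T_scale.
have -> : T (fun a b c d => sq b) = Taa by rewrite T_swap_left.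
have -> : T (fun a b c d => sq c) = Taa by rewrite T_swap_sides.
have -> : T (fun a b c d => sq d) = Taa by rewrite T_swap_right T_swap_sides.
have -> : T (fun a b c d => c%:R * d%:R) = Tab by rewrite T_swap_sides.
have -> : T (fun a b c d => a%:R * d%:R) = Tac by rewrite T_swap_right.
have -> : T (fun a b c d => b%:R * c%:R) = Tac by rewrite T_swap_left.
have -> : T (fun a b c d => b%:R * d%:R) = Tac by rewrite T_swap_left T_swap_right.
by rewrite -/Taa -/Tab -/Tac; ring.
Qed.

Lemma fourth_moment_T :
  fourth_moment n g = T (fun _ _ _ _ => 1) - n%:R^-2 * (4 * Taa + 4 * Tab - 8 * Tac).
Proof.
rewrite -T_square_expansion -T_scale -mulN1r -T_scale -T_add.
apply: eq_bigr => a _; apply: eq_bigr => b _; apply: eq_bigr => c _.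
apply: eq_bigr => d _; rewrite (additive_quadruple_indicator (n := n)) //.
by rewrite /K; ring.
Qed.

(* Only the diagonal survives, because the class sums of [chi] vanish. *)
Lemma T_left (phi : nat -> F) :
  T (fun a _ _ _ => phi a) = n%:R * \sum_(a < n) g a ^+ 2 * phi a.
Proof.
rewrite (T_ac (fun a _ => phi a)) [X in _ + X]big1 ?addr0 // => a _.
rewrite big_seq big1 // => ds dsL; have dn := Ls_dvd dsL.
have nE : (n = ds.1 * (n %/ ds.1))%N by rewrite mulnC divnK.
have d0 : (0 < ds.1)%N by exact: dvdn_gt0 dn.
have := sum_residue_class (n %/ ds.1) (fun c => g a * g c * phi a) a d0.
rewrite -nE => ->; rewrite -mulr_suml -mulr_sumr.
rewrite (_ : \sum_(t < _) _ = 0) ?mulr0 ?mul0r ?mulr0 //.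
apply: etrans (Ls_sum (a %% ds.1 + R0) dsL); apply: eq_bigr => t _.
by rewrite /g addnAC.
Qed.

Lemma fourth_moment_main_terms :
  `|fourth_moment n g - (n%:R * (\sum_(a < n) g a ^+ 2) -
     4 / n%:R * \sum_(a < n) g a ^+ 2 * (a%:R * (k a)%:R - a%:R ^+ 2))|
  <= 36 * n%:R ^+ 2 * eta.
Proof.
have n0 : 0 < n%:R :> F by rewrite ltr0n.
rewrite fourth_moment_T /Taa /Tab /Tac.
rewrite (T_left (fun=> 1)) (T_left (fun a => a%:R ^+ 2)).
rewrite (T_ac (fun a c => a%:R * c%:R)) (T_ab (fun a b => a%:R * b%:R)).
have := error_bound id; have := error_bound (fun a => kappa + n - a)%N.
set E1 := \sum_(a < n) \sum_(ds <- Ls) _; set E2 := \sum_(a < n) \sum_(ds <- Ls) _.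
have -> : \sum_(a < n) g a ^+ 2 * 1 = \sum_(a < n) g a ^+ 2.
  by apply: eq_bigr => a _; rewrite mulr1.
have -> : \sum_(a < n) g a ^+ 2 * (a%:R * a%:R) = \sum_(a < n) g a ^+ 2 * a%:R ^+ 2.
  by apply: eq_bigr => a _; rewrite expr2.
under [X in 4 / n%:R * X]eq_bigr do rewrite mulrBr.
rewrite sumrB.
set s0 := \sum_(a < n) g a ^+ 2; set s1 := \sum_(a < n) _ * (_ * _).
set s2 := \sum_(a < n) _ * _ ^+ 2.
move=> e1 e2.
(* The diagonal parts cancel exactly. Both error sums are at most [3 n^4 eta], and
   [8 * 3 + 4 * 3 = 36]. *)
have -> : n%:R * s0 - n%:R ^- 2 * (4 * (n%:R * s2) + 4 * (n%:R * s1 + eps * E1) -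
    8 * (n%:R * s2 + E2)) - (n%:R * s0 - 4 / n%:R * (s1 - s2)) =
    n%:R ^- 2 * (8 * E2 - 4 * (eps * E1)).
  by field; rewrite gt_eqF.
rewrite normrM normfV normrX normr_nat mulrC ler_pdivrMr ?exprn_gt0 //.
apply: le_trans (ler_normB _ _) _.
by rewrite !normrM eps_norm mul1r !normr_nat; lra.
Qed.

Let w : F := \sum_(a < n) (1 - (coprime a n)%:R).

Lemma sum_noncoprime : \sum_(a < n) (1 - g a ^+ 2) = w.
Proof.
pose f a := 1 - chi a ^+ 2.
have fP : periodic n f by move=> a; rewrite /f chi_per.
rewrite (eq_bigr (fun a : 'I_n => f (a + R0)%N)) // sum_periodic_shift //.
by apply: eq_bigr => a _; rewrite /f chi_sq.
Qed.

(** [g a ^+ 2] is 1 except at [w] places. Replacing it by 1 costs [n w] in the first sum and at most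
    [(4/n) n^2 w] in the second. *)
Lemma remove_weights :
  `|(n%:R * (\sum_(a < n) g a ^+ 2) -
     4 / n%:R * \sum_(a < n) g a ^+ 2 * (a%:R * (k a)%:R - a%:R ^+ 2)) -
   (n%:R ^+ 2 - 4 / n%:R * \sum_(a < n) (a%:R * (k a)%:R - a%:R ^+ 2))|
  <= 5 * n%:R * w.
Proof.
have n0 : 0 < n%:R :> F by rewrite ltr0n.
set D := \sum_(a < n) (1 - g a ^+ 2) * (a%:R * (k a)%:R - a%:R ^+ 2).
have -> : \sum_(a < n) (a%:R * (k a)%:R - a%:R ^+ 2) =
    D + \sum_(a < n) g a ^+ 2 * (a%:R * (k a)%:R - a%:R ^+ 2).
  by rewrite -big_split; apply: eq_bigr => a _ /=; ring.
have wE : w = n%:R - \sum_(a < n) g a ^+ 2.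
  by rewrite -sum_noncoprime sumrB sumr_const card_ord.
have DB : `|D| <= n%:R ^+ 2 * w.
  rewrite -sum_noncoprime mulr_sumr; apply: le_trans (ler_norm_sum _ _ _) _.
  apply: ler_sum => a _; rewrite normrM mulrC.
  have g01 : 0 <= 1 - g a ^+ 2 by rewrite chi_sq; case: (coprime _ n); rewrite ?subrr ?subr0.
  rewrite (ger0_norm g01) ler_wpM2r //.
  have a0 : 0 <= a%:R :> F by [].
  have an : a%:R <= n%:R :> F by rewrite ler_nat ltnW.
  have k0 : 0 <= (k a)%:R :> F by [].
  have kn : (k a)%:R <= n%:R :> F by rewrite ler_nat ltnW // ltn_pmod.
  rewrite ler_norml; nra.
set Z := \sum_(a < n) _ * _.
have -> : n%:R * (\sum_(a < n) g a ^+ 2) - 4 / n%:R * Z - (n%:R ^+ 2 - 4 / n%:R * (D + Z))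
   = 4 / n%:R * D - n%:R * w by rewrite wE; ring.
have w0 : 0 <= w.
  by rewrite /w sumr_ge0 // => a _; case: (coprime a n); rewrite ?subrr ?subr0.
apply: le_trans (ler_normB _ _) _.
rewrite normrM (@ger0_norm _ (n%:R * w)) ?mulr_ge0 //.
rewrite (@ger0_norm _ (4 / n%:R)) ?divr_ge0 //.
have : 4 / n%:R * `|D| <= 4 / n%:R * (n%:R ^+ 2 * w) by rewrite ler_wpM2l ?divr_ge0.
have -> : 4 / n%:R * (n%:R ^+ 2 * w) = 4 * n%:R * w by field; rewrite gt_eqF.
lra.
Qed.

Lemma sum_nat_ord m : \sum_(a < m) a%:R = m%:R * (m%:R - 1) / 2 :> F.
Proof.
elim: m => [|m IH]; first by rewrite big_ord0 !mul0r.
by rewrite big_ord_recr /= IH -natr1; field.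
Qed.

Lemma sum_square_ord m :
  \sum_(a < m) a%:R ^+ 2 = m%:R * (m%:R - 1) * (2 * m%:R - 1) / 6 :> F.
Proof.
elim: m => [|m IH]; first by rewrite big_ord0 !mul0r.
by rewrite big_ord_recr /= IH -natr1; field.
Qed.

Lemma reflection_sum :
  \sum_(a < n) (a%:R * (k a)%:R - a%:R ^+ 2) =
  (kappa%:R + n%:R) * (n%:R * (n%:R - 1) / 2)
  - 2 * (n%:R * (n%:R - 1) * (2 * n%:R - 1) / 6)
  - n%:R * ((kappa%:R + 1) * kappa%:R / 2) :> F.
Proof.
have kn : (kappa < n)%N by rewrite ltn_pmod.
(* The reflection is [kappa - a] up to [a = kappa] and [kappa + n - a] beyond, so one indicator of
   [a < kappa + 1] describes it. *)
have kE (a : 'I_n) :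
    (k a)%:R = kappa%:R + n%:R - a%:R - (a < kappa.+1)%N%:R * n%:R :> F.
  have an := ltn_ord a; rewrite /k; case: ltnP => ak.
    rewrite mul1r -addnBAC // modnDr modn_small; last by lia.
    by rewrite natrB //; ring.
  rewrite mul0r subr0 modn_small; last by lia.
  by rewrite natrB ?natrD //; lia.
rewrite (eq_bigr (fun a : 'I_n => (kappa%:R + n%:R) * a%:R - 2 * a%:R ^+ 2
   - n%:R * ((a < kappa.+1)%N%:R * a%:R))); last by move=> a _; rewrite kE; ring.
rewrite !sumrB -!mulr_sumr sum_nat_ord sum_square_ord; congr (_ - _ * _).
have -> : (kappa%:R + 1) * kappa%:R / 2 = \sum_(a < kappa.+1) a%:R :> F.
  by rewrite sum_nat_ord -natr1; ring.
rewrite (big_ord_widen n (fun a => a%:R)) // [RHS]big_mkcond /=.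
by apply: eq_bigr => a _; case: ltnP; rewrite ?mul1r ?mul0r.
Qed.

Theorem fourth_moment_estimate x : x = kappa%:R / n%:R ->
  `|fourth_moment n g - n%:R ^+ 2 * (5 / 3 - 2 * x * (1 - x))|
  <= n%:R * (5 * w + 8) + 36 * n%:R ^+ 2 * eta.
Proof.
move=> xE.
have n0 : 0 < n%:R :> F by rewrite ltr0n.
have n1 : 1 <= n%:R :> F by rewrite ler1n.
have x0 : 0 <= x by rewrite xE divr_ge0.
have x1 : x <= 1 by rewrite xE ler_pdivrMr // mul1r ler_nat ltnW // ltn_pmod.
have := fourth_moment_main_terms; have := remove_weights.
rewrite reflection_sum.
have -> : kappa%:R = x * n%:R by rewrite xE divfK // gt_eqF.
set A := fourth_moment n g; set B := (_ - _ * \sum_(a < n) _).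
(* The closed form splits into the quadratic main term and a remainder of size [O(n)], which is put
   into [8 n]. *)
have -> : n%:R ^+ 2 - 4 / n%:R *
    ((x * n%:R + n%:R) * (n%:R * (n%:R - 1) / 2) -
     2 * (n%:R * (n%:R - 1) * (2 * n%:R - 1) / 6) -
     n%:R * ((x * n%:R + 1) * (x * n%:R) / 2)) =
   n%:R ^+ 2 * (5 / 3 - 2 * x * (1 - x)) + (n%:R * (4 * x - 2) + 4 / 3).
  by field; rewrite gt_eqF.
set m := n%:R ^+ 2 * _.
have : `|n%:R * (4 * x - 2) + 4 / 3| <= 8 * n%:R by rewrite ler_norml; nra.
have -> : n%:R * (5 * w + 8) = 5 * n%:R * w + 8 * n%:R by ring.
set c := (_ + 4 / 3); move: (36 * _ * eta) (5 * n%:R * w) => e1 e2 h1 h2 h3.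
have -> : A - m = (A - B) + (B - (m + c)) + c by ring.
apply: le_trans (ler_normD _ _) _.
apply: le_trans (lerD (ler_normD _ _) (lexx _)) _.
lra.
Qed.

End FourthMoment.

(** * The quadratic character of a prime field *)

Section QuadraticCharacter.
Local Open Scope ring_scope.
Variables (F : realFieldType) (p : nat).

Definition quad_char (x : 'F_p) : F :=
  if x == 0 then 0 else if [exists y : 'F_p, y ^+ 2 == x] then 1 else -1.

Lemma sum_Fp (h : 'F_p -> F) : prime p ->
  \sum_(a < p) h (a : nat)%:R = \sum_(x : 'F_p) h x.
Proof.
move=> p_pr; rewrite -(big_mkord xpredT (fun a => h a%:R)).
rewrite -[p in index_iota _ p](Fp_cast p_pr) big_mkord.
by apply: eq_bigr => x _; rewrite natr_Zp.
Qed.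

Lemma sum_Fp_affine (h : 'F_p -> F) (d s : nat) : prime p -> coprime p d ->
  \sum_(t < p) h (s + d * t)%N%:R = \sum_(x : 'F_p) h x.
Proof.
move=> p_pr pd; have d0 : d%:R != 0 :> 'F_p.
  by rewrite -(dvdn_pcharf (pchar_Fp p_pr)) -prime_coprime.
rewrite [RHS](reindex (fun x => s%:R + d%:R * x)).
  rewrite -(sum_Fp (fun x => h (s%:R + d%:R * x)) p_pr).
  by apply: eq_bigr => t _; rewrite natrD natrM.
by exists (fun x => d%:R^-1 * (x - s%:R)) => x _;
  [rewrite addrC addKr mulKf | rewrite mulVKf // addrC subrK].
Qed.

Hypotheses (p_pr : prime p) (p_odd : odd p).

(** The unit group is cyclic of even order [p - 1], so the parity of an exponent depends only on the
    power. *)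
Lemma primitive_element :
  exists g : 'F_p, [/\ g != 0, forall x, x != 0 -> exists i, x = g ^+ i
    & forall i j, g ^+ i = g ^+ j -> odd i = odd j].
Proof.
have /cyclicP [u Eu] := field_unit_group_cyclic [group of [set: {unit 'F_p}]].
have ou : #[u]%g = p.-1.
  by rewrite /order -Eu card_finField_unit card_Fp.
exists (val u); split.
- by rewrite -unitfE; apply: valP.
- move=> x; rewrite -unitfE => ux.
  have : FinRing.unit 'F_p ux \in <[u]>%g by rewrite -Eu inE.
  by case/cycleP => i /(congr1 val); rewrite FinRing.val_unitX /= => E; exists i.
- move=> i j; rewrite -!FinRing.val_unitX => /val_inj /eqP; rewrite eq_expg_mod_order ou.
  have p1 : odd p.-1 = false by move: p_odd (prime_gt0 p_pr); case: (p) => //= m; case: odd.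
  by move/eqP=> E; rewrite (divn_eq i p.-1) (divn_eq j p.-1) E !oddD !oddM p1 !andbF.
Qed.

(** The nonzero squares are the even powers of a generator; in this form multiplicativity is
    immediate. *)
Lemma quad_charX : exists g : 'F_p,
  (forall x, x != 0 -> exists i, x = g ^+ i) /\
  (forall i, quad_char (g ^+ i) = (-1) ^+ i).
Proof.
have [g [g0 gP gI]] := primitive_element; exists g; split => // i.
rewrite /quad_char expf_eq0 (negbTE g0) andbF -signr_odd.
case: existsP => [[y /eqP yE]|nsq].
  have y0 : y != 0.
    apply: contraNneq g0 => y0; move: yE.
    by rewrite y0 expr0n /= => /esym/eqP; rewrite expf_eq0 => /andP[].
  have [j yj] := gP y y0; move: yE; rewrite yj -exprM => /gI.
  by rewrite oddM andbF => <-.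
case: (boolP (odd i)) => // oi; case: nsq; exists (g ^+ i./2).
by rewrite -exprM muln2 -[X in _ == g ^+ X]odd_double_half (negbTE oi).
Qed.

Lemma quad_char0 : quad_char 0 = 0.
Proof. by rewrite /quad_char eqxx. Qed.

Lemma quad_charM x y : quad_char (x * y) = quad_char x * quad_char y.
Proof.
have [->|x0] := eqVneq x 0; first by rewrite mul0r quad_char0 mul0r.
have [->|y0] := eqVneq y 0; first by rewrite mulr0 quad_char0 mulr0.
have [g [gP gE]] := quad_charX.
by have [i ->] := gP x x0; have [j ->] := gP y y0; rewrite -exprD !gE exprD.
Qed.

Lemma quad_char_sq x : quad_char x ^+ 2 = (x != 0)%:R.
Proof.
rewrite /quad_char; case: eqP => _ /=; first by rewrite expr0n.
by case: ifP; rewrite ?sqrrN expr1n.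
Qed.

(** Multiplication by a generator permutes the field and negates the character. *)
Lemma sum_quad_char : \sum_(x : 'F_p) quad_char x = 0.
Proof.
have [g [gP gE]] := quad_charX.
have gc : quad_char g = -1 by rewrite -[g]expr1 gE expr1.
have g0 : g != 0.
  apply: contraTneq isT => g0; move: gc.
  by rewrite g0 quad_char0 => /eqP; rewrite eq_sym oppr_eq0 oner_eq0.
have : \sum_(x : 'F_p) quad_char x = - \sum_(x : 'F_p) quad_char x.
  rewrite {1}(reindex (fun x => g * x)) /=.
    by rewrite -sumrN; apply: eq_bigr => x _; rewrite quad_charM gc mulN1r.
  by exists (fun x => g^-1 * x) => x _; rewrite ?mulKf ?mulVKf.
lra.
Qed.

Lemma corr_quad_char (u : 'F_p) :
  \sum_(x : 'F_p) quad_char x * quad_char (x + u) = (u == 0)%:R * p%:R - 1.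
Proof.
have [->|u0] := eqVneq u 0.
  rewrite mul1r (bigD1 0) //= addr0 quad_char0 mul0r add0r.
  rewrite (eq_bigr (fun=> 1)) => [|x x0]; last by rewrite addr0 -expr2 quad_char_sq x0.
  rewrite sumr_const; have := cardC1 (0 : 'F_p); rewrite card_Fp // => ->.
  by rewrite -subn1 natrB ?prime_gt0.
rewrite mul0r sub0r (bigD1 0) //= quad_char0 mul0r add0r.
(* For [x != 0] the product is the character of [1 + u / x]. With the convention [0^-1 = 0] this map
   permutes the whole field, and its value 1 at [x = 0] accounts for the final [-1]. *)
have : \sum_(x : 'F_p) quad_char (1 + u * x^-1) = 0.
  rewrite -[RHS]sum_quad_char [RHS](reindex (fun x => 1 + u * x^-1)) //=.
  exists (fun y => u * (y - 1)^-1) => x _.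
    by rewrite addrC addKr invfM invrK mulVKf.
  by rewrite invfM invrK mulVKf // addrC subrK.
rewrite (bigD1 0) //= invr0 mulr0 addr0.
have -> : quad_char 1 = 1.
  by have [g [_ gE]] := quad_charX; rewrite -(expr0 g) gE.
rewrite addrC => /eqP; rewrite addr_eq0 => /eqP <-; apply: eq_bigr => x x0.
have -> : x + u = x * (1 + u * x^-1) by rewrite mulrDr mulr1 mulrCA divff // mulr1.
by rewrite quad_charM mulrA -expr2 quad_char_sq x0 mul1r.
Qed.

End QuadraticCharacter.

(** * Prime modulus *)

Section LegendreSequence.
Local Open Scope ring_scope.
Variables (F : realFieldType) (p : nat).
Hypotheses (p_pr : prime p) (p_odd : odd p).

Definition legendre_seq (q a : nat) : F := quad_char F (a%:R : 'F_q).
Let chi := legendre_seq p.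
Let eps : F := quad_char F (-1 : 'F_p).

Lemma natr_Fp_eq0 a : ((a%:R : 'F_p) == 0) = (p %| a)%N.
Proof. by rewrite (dvdn_pcharf (pchar_Fp p_pr)). Qed.

Lemma legendre_seq_per : periodic p chi.
Proof. by move=> a; rewrite /chi /legendre_seq natrD pchar_Fp_0 // addr0. Qed.

Lemma legendre_seq_sq a : chi a ^+ 2 = (coprime a p)%:R.
Proof. by rewrite quad_char_sq natr_Fp_eq0 coprime_sym prime_coprime. Qed.

Lemma legendre_seq_opp a b : (p %| a + b)%N -> chi a = eps * chi b.
Proof.
rewrite -natr_Fp_eq0 natrD addr_eq0 => /eqP E.
by rewrite /chi /legendre_seq E -mulN1r quad_charM.
Qed.

Lemma legendre_eps_sq : eps ^+ 2 = 1.
Proof. by rewrite quad_char_sq oppr_eq0 oner_eq0. Qed.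

Lemma sum_legendre_affine d s : coprime p d ->
  \sum_(t < p) chi (s + d * t)%N = 0.
Proof. by move=> pd; rewrite (sum_Fp_affine (quad_char F (p := p))) // sum_quad_char. Qed.

Lemma corr_legendre_affine d s u : coprime p d ->
  \sum_(t < p) chi (s + d * t)%N * chi (s + d * t + u)%N
  = (p %| u)%:R * p%:R - 1.
Proof.
move=> pd; rewrite -natr_Fp_eq0 -corr_quad_char //.
rewrite -(sum_Fp_affine (fun x => quad_char F x * quad_char F (x + u%:R)) s p_pr pd).
by apply: eq_bigr => t _; rewrite /chi /legendre_seq [in X in _ * X]natrD.
Qed.

Lemma corr_legendre u :
  \sum_(a < p) chi a * chi (a + u)%N = (p %| u)%:R * p%:R - 1.
Proof.
rewrite -(corr_legendre_affine 0 u (coprimen1 p)).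
by apply: eq_bigr => t _; rewrite add0n mul1n.
Qed.

(** The autocorrelation is [p [p | u] - 1], so the only proper divisor is 1, with [sigma = -1]. *)
Lemma legendre_flat : flat_character p p chi eps [:: (1%N, -1)].
Proof.
split.
- exact: legendre_seq_per.
- exact: legendre_seq_sq.
- exact: legendre_seq_opp.
- exact: legendre_eps_sq.
- by move=> u; rewrite corr_legendre big_seq1 /= dvd1n !mulr1.
- by [].
- by move=> ds; rewrite inE => /eqP -> /=.
- by move=> ds; rewrite inE => /eqP -> /=; rewrite normrN normr1.
- by move=> ds; rewrite inE => /eqP -> /=; rewrite divn1.
- by move=> ds s; rewrite inE => /eqP -> /=; rewrite divn1 sum_legendre_affine ?coprimen1.
- move=> ds s l; rewrite inE => /eqP -> /= lp; rewrite divn1.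
  under eq_bigr do rewrite mulnDr addnA.
  rewrite corr_legendre_affine ?coprimen1 // mul1n gtnNdvd; try lia.
  by rewrite mul0r sub0r normrN normr1.
Qed.

End LegendreSequence.

(** * Product of two distinct odd primes *)

Section JacobiSequence.
Local Open Scope ring_scope.
Variables (F : realFieldType) (p q : nat).
Hypotheses (p_pr : prime p) (p_odd : odd p) (q_pr : prime q) (q_odd : odd q).
Hypothesis pq : (p < q)%N.

Let chi a : F := legendre_seq F p a * legendre_seq F q a.
Let eps : F := quad_char F (-1 : 'F_p) * quad_char F (-1 : 'F_q).

Let cop_pq : coprime p q.
Proof. by rewrite coprime_sym prime_coprime // gtnNdvd // prime_gt0. Qed.

Lemma legendre_seq_mod r a b : prime r -> a = b %[mod r] ->
  legendre_seq F r a = legendre_seq F r b.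
Proof. by move=> r_pr; apply: periodic_eqmod; apply: legendre_seq_per. Qed.

Lemma legendre_seqDM r s t : prime r -> legendre_seq F r (s + r * t) = legendre_seq F r s.
Proof. by move=> r_pr; apply: legendre_seq_mod => //; rewrite mulnC addnC modnMDl. Qed.

Lemma legendre_seqDMD r s t u : prime r ->
  legendre_seq F r (s + r * t + u) = legendre_seq F r (s + u).
Proof. by move=> r_pr; rewrite addnAC legendre_seqDM. Qed.

(* Summing over a class modulo [r] freezes the factor of modulus [r]. *)
Lemma class_sum r r' s : prime r -> prime r' -> odd r' -> coprime r r' ->
  \sum_(t < r') legendre_seq F r (s + r * t) * legendre_seq F r' (s + r * t) = 0.
Proof.
move=> rP rP' o c; under eq_bigr do rewrite legendre_seqDM //.
by rewrite -mulr_sumr sum_legendre_affine ?mulr0 // coprime_sym.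
Qed.

Lemma class_corr r r' s u : prime r -> prime r' -> odd r' -> coprime r r' ->
  \sum_(t < r') legendre_seq F r (s + r * t) * legendre_seq F r' (s + r * t) *
    (legendre_seq F r (s + r * t + u) * legendre_seq F r' (s + r * t + u)) =
  legendre_seq F r s * legendre_seq F r (s + u) * ((r' %| u)%:R * r'%:R - 1).
Proof.
move=> rP rP' o c; rewrite -(@corr_legendre_affine F r' rP' o r s u) 1?coprime_sym //.
rewrite mulr_sumr; apply: eq_bigr => t _.
by rewrite legendre_seqDM // legendre_seqDMD //; ring.
Qed.

Lemma jacobi_seq_per : periodic (p * q) chi.
Proof.
move=> a; rewrite /chi legendre_seqDM // mulnC legendre_seqDM //.
Qed.

(** Within a class modulo [p] the correlation modulo [q] factors out, so the autocorrelation is the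
    product of the two prime ones. *)
Lemma corr_jacobi u : \sum_(a < p * q) chi a * chi (a + u)%N =
  ((p %| u)%:R * p%:R - 1) * ((q %| u)%:R * q%:R - 1).
Proof.
rewrite (sum_mul_split p q (fun a => chi a * chi (a + u)%N)).
rewrite -(corr_legendre F p_pr p_odd u) mulr_suml; apply: eq_bigr => s _.
exact: class_corr.
Qed.

(** Expanding [(p [p | u] - 1)(q [q | u] - 1)] gives the three proper divisors with their signs.
    Their cofactors [q], [p] and [p q] are all at least [p], and a lag [0 < l < p] is divisible by
    neither prime, so all correlations along classes are at most 1 in absolute value. *)
Lemma jacobi_flat :
  flat_character (p * q) p chi eps [:: (p, -1); (q, -1); (1%N, 1)].
Proof.
have p0 := prime_gt0 p_pr; have q0 := prime_gt0 q_pr; have p1 := prime_gt1 p_pr.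
have cop_qp : coprime q p by rewrite coprime_sym.
have chi1 a : `|legendre_seq F p a * legendre_seq F p a| <= 1.
  by rewrite -expr2 legendre_seq_sq //; case: coprime; rewrite ?normr1 ?normr0.
have chi1' a : `|legendre_seq F q a * legendre_seq F q a| <= 1.
  by rewrite -expr2 legendre_seq_sq //; case: coprime; rewrite ?normr1 ?normr0.
have LsP (P : nat * F -> Prop) : P (p, -1) -> P (q, -1) -> P (1%N, 1) ->
    forall ds, ds \in [:: (p, -1); (q, -1); (1%N, 1)] -> P ds.
  by move=> P1 P2 P3 ds; rewrite !inE => /or3P[] /eqP ->.
split.
- exact: jacobi_seq_per.
- by move=> a; rewrite exprMn !legendre_seq_sq // coprimeMr -natrM mulnb.
- move=> a b ab; rewrite /chi /eps.
  rewrite (legendre_seq_opp F p_pr p_odd (dvdn_trans (dvdn_mulr _ (dvdnn p)) ab)).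
  rewrite (legendre_seq_opp F q_pr q_odd (dvdn_trans (dvdn_mull _ (dvdnn q)) ab)).
  by ring.
- by rewrite exprMn !legendre_eps_sq ?mulr1.
- move=> u; rewrite corr_jacobi Gauss_dvd // !big_cons big_nil /= dvd1n.
  by case: (p %| u)%N; case: (q %| u)%N; rewrite natrM /=; ring.
- by [].
- by apply: LsP => /=; [apply: dvdn_mulr | apply: dvdn_mull | apply: dvd1n].
- by apply: LsP => /=; rewrite ?normrN normr1.
- apply: LsP => /=; rewrite ?mulKn ?mulnK ?divn1 //; first exact: ltnW.
  by rewrite leq_pmulr.
- move=> ds s dsL; move: ds dsL s; apply: LsP => /= s.
  + by rewrite mulKn // class_sum.
  + rewrite mulnK //; under eq_bigr do rewrite /chi mulrC.
    by rewrite class_sum.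
  + rewrite divn1; under eq_bigr do rewrite mul1n addnC.
    rewrite (sum_periodic_shift s jacobi_seq_per) sum_mul_split big1 // => i _.
    by rewrite class_sum.
- move=> ds s l dsL; move: ds dsL s l; apply: LsP => /= s l lp.
  + rewrite mulKn //; under eq_bigr do rewrite mulnDr addnA.
    rewrite class_corr // legendre_seqDM // Gauss_dvdr // gtnNdvd; try lia.
    by rewrite mul0r sub0r mulrN1 normrN.
  + rewrite mulnK //; under eq_bigr do
      rewrite mulnDr addnA /chi mulrC [X in X * _]mulrC [X in _ * X]mulrC mulrC.
    rewrite class_corr // legendre_seqDM // Gauss_dvdr // gtnNdvd; try lia.
    by rewrite mul0r sub0r mulrN1 normrN.
  + rewrite divn1; under eq_bigr do rewrite !mul1n addnA.
    pose f t := chi t * chi (t + l)%N.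
    have fP : periodic (p * q) f by move=> t; rewrite /f jacobi_seq_per addnAC jacobi_seq_per.
    rewrite (eq_bigr (fun t : 'I_(p * q) => f (t + s)%N)); last first.
      by move=> t _; rewrite /f [(s + t)%N]addnC.
    rewrite (sum_periodic_shift s fP) corr_jacobi !gtnNdvd; try lia.
    by rewrite !mul0r !sub0r mulrNN mulr1 normr1.
Qed.

End JacobiSequence.

Delimit Scope R_scope with coqR.

(** * Transfer to the concrete Jacobi symbol *)

Section JacobiSymbol.
Local Open Scope ring_scope.
Notation RR := Rdefinitions.R.

Lemma rsumE N (f : nat -> RR) : rsum N f = \sum_(j < N) f j.
Proof.
by elim: N => [|N IH]; rewrite ?big_ord0 //= big_ord_recr /= -IH.
Qed.

Lemma indicE (b : bool) : indic b = b%:R :> RR.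
Proof. by case: b. Qed.

Lemma eqbE (a b : nat) : Nat.eqb a b = (a == b).
Proof. by elim: a b => [|a IH] [|b] //=; rewrite IH. Qed.

Lemma quad_energyE N x : quad_energy N x = fourth_moment N x.
Proof.
rewrite /quad_energy /fourth_moment rsumE; apply: eq_bigr => a _.
rewrite rsumE; apply: eq_bigr => b _; rewrite rsumE; apply: eq_bigr => c _.
by rewrite rsumE; apply: eq_bigr => d _; rewrite indicE eqbE.
Qed.

Lemma mod_modn a p : (0 < p)%N -> Nat.modulo a p = (a %% p)%N.
Proof.
move=> p0; apply/esym/(Nat.mod_unique _ _ (a %/ p)); first by apply/ssrnat.ltP; rewrite ltn_pmod.
by rewrite [LHS](divn_eq a p) mulnC.
Qed.

Lemma existsbE (T : eqType) (P : pred T) (s : seq T) : List.existsb P s = has P s.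
Proof. by elim: s => //= x s ->. Qed.

Lemma seq_iota m k : List.seq m k = iota m k.
Proof. by elim: k m => //= k IH m; rewrite IH. Qed.

Lemma legendreE a p : prime p -> IZR (legendre a p) = legendre_seq RR p a.
Proof.
move=> p_pr; have p0 := prime_gt0 p_pr.
rewrite /legendre /legendre_seq /quad_char natr_Fp_eq0 // mod_modn // eqbE.
rewrite -/(dvdn p a); case: (boolP (p %| a)%N) => // _.
rewrite existsbE seq_iota.
have -> : has (fun x => Nat.eqb (Nat.modulo (Nat.mul x x) p) (a %% p)) (iota 0 p) =
    [exists y : 'F_p, y ^+ 2 == a%:R]; last by case: [exists y, _].
have eqF (b c : nat) : ((b%:R : 'F_p) == c%:R) = (b == c %[mod p]).
  by rewrite -(inj_eq val_inj) /= !val_Fp_nat.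
apply/hasP/existsP => [[x _]|[y /eqP yE]].
  rewrite mod_modn // eqbE => E; exists x%:R.
  by rewrite -natrX eqF expnS expn1.
exists (y : nat); first by rewrite mem_iota add0n /= -[X in (_ < X)%N](Fp_cast p_pr).
rewrite mod_modn // eqbE -[(_ * _)%coq_nat]/(y * y)%N -eqF natrM natr_Zp.
by rewrite -expr2 yE.
Qed.

Lemma jacobi_prime a p : prime p -> IZR (jacobi a p) = legendre_seq RR p a.
Proof.
move=> p_pr; rewrite /jacobi primes_prime //= logn_prime // eqxx.
by rewrite Z.mul_1_r Z.pow_1_r legendreE.
Qed.

Lemma primes_mul_lt p q : prime p -> prime q -> (p < q)%N -> primes (p * q) = [:: p; q].
Proof.
move=> p_pr q_pr pq; apply: (irr_sorted_eq ltn_trans ltnn (sorted_primes _)) => //=.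
  by rewrite pq.
by move=> x; rewrite primesM ?prime_gt0 // !primes_prime // !inE.
Qed.

Lemma jacobi_mul a p q : prime p -> prime q -> (p < q)%N ->
  IZR (jacobi a (p * q)) = legendre_seq RR p a * legendre_seq RR q a.
Proof.
move=> p_pr q_pr pq; rewrite /jacobi primes_mul_lt //=.
rewrite !lognM ?prime_gt0 // !logn_prime // !eqxx eq_sym.
have -> : (q == p) = false by rewrite gtn_eqF.
by rewrite Z.mul_1_r !Z.pow_1_r mult_IZR !legendreE.
Qed.

Lemma gcd_gcdn a b : Nat.gcd a b = gcdn a b.
Proof.
apply: Nat.gcd_unique.
- by have /dvdnP [k E] := dvdn_gcdl a b; exists k.
- by have /dvdnP [k E] := dvdn_gcdr a b; exists k.
- move=> q [k Ek] [l El]; have /dvdnP [m E] : (q %| gcdn a b)%N.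
    by rewrite dvdn_gcd; apply/andP; split; apply/dvdnP; [exists k | exists l].
  by exists m.
Qed.

Lemma gcd_coprime a n : Nat.eqb (Nat.gcd a n) 1 = coprime a n.
Proof. by rewrite eqbE gcd_gcdn. Qed.

(** Beside [p], take the least prime factor of [n / p]; it differs from [p] because [n] is
    square-free. A further factor above 1 would be at least [p], and [n] would reach [p^3]. *)
Lemma two_prime_factors n : squarefree n -> (1 < n)%N -> (n < pdiv n ^ 3)%N ->
  prime n \/ exists q, [/\ prime q, (pdiv n < q)%N & n = (pdiv n * q)%N].
Proof.
move=> sq n1 n3; set p := pdiv n in n3 *.
have p_pr : prime p by apply: pdiv_prime.
have /dvdnP [m nE] : (p %| n)%N by apply: pdiv_dvd.
have pmin d : (1 < d)%N -> (d %| n)%N -> (p <= d)%N by move=> d1 dn; apply: pdiv_min_dvd.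
have n0 : (0 < n)%N by apply: ltnW.
have [m1|m1] := leqP m 1.
  by left; have : m = 1%N by [lia]; move=> m1'; rewrite nE m1' mul1n.
right; exists (pdiv m).
have q_pr : prime (pdiv m) by apply: pdiv_prime.
have /dvdnP [m' mE] := pdiv_dvd m.
have qn : (pdiv m %| n)%N by rewrite nE; apply: dvdn_mulr; apply: pdiv_dvd.
have pq : (p <= pdiv m)%N by apply: pmin => //; apply: prime_gt1.
have neq : p <> pdiv m.
  move=> E; have : p = 1%N.
    by apply: sq; exists m'; rewrite nE mE -E /=; nia.
  by have := prime_gt1 p_pr; lia.
split=> //; first by lia.
have [m'1|m'1] := leqP m' 1.
  have : m' = 1%N by nia.
  by move=> m'E; rewrite {1}nE {1}mE m'E mul1n mulnC.
have : (p <= m')%N by apply: pmin => //; rewrite nE mE -mulnA dvdn_mulr.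
move=> pm'; exfalso; move: n3; rewrite ltnNge => /negP[].
rewrite !expnS expn0 muln1 mulnA [X in (_ <= X)%N]nE {1}mE.
by rewrite leq_mul // leq_mul.
Qed.

(** The sum in the second conjunct is [n] minus Euler's totient: 1 for a prime, and
    [p + q - 1 <= 2 q = 2 n / p] for two primes. *)
Lemma jacobi_flat_character n : odd n -> squarefree n -> (1 < n)%N -> (n < pdiv n ^ 3)%N ->
  exists eps Ls, flat_character n (pdiv n) (fun a => IZR (jacobi a n)) eps Ls /\
    (- \sum_(ds <- Ls) ds.2 * ds.1%:R <= 2 * n%:R / (pdiv n)%:R :> RR).
Proof.
move=> n_odd sq n1 n3.
have [n_pr|[q [q_pr pq nE]]] := two_prime_factors sq n1 n3.
  rewrite pdiv_id //; exists (quad_char RR (-1 : 'F_n)), [:: (1%N, -1)].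
  split.
    have := legendre_flat RR n_pr n_odd; congr flat_character.
    by apply: boolp.funext => a; rewrite jacobi_prime.
  rewrite big_seq1 /= mulr1 opprK mulfK ?ler1n //.
  by rewrite pnatr_eq0; lia.
have p_pr : prime (pdiv n) by apply: pdiv_prime.
move: n_odd; rewrite {1}nE oddM => /andP[p_odd q_odd].
have := jacobi_flat RR p_pr p_odd q_pr q_odd pq.
rewrite -nE; set p := pdiv n in p_pr pq nE p_odd *.
set eps := _ * _; set Ls := [:: _; _; _] => fl.
exists eps, Ls; split.
  move: fl; congr flat_character; apply: boolp.funext => a.
  by rewrite nE jacobi_mul.
have p0 : 0 < p%:R :> RR by rewrite ltr0n prime_gt0.
have pq' : p%:R <= q%:R :> RR by rewrite ler_nat ltnW.
rewrite /Ls !big_cons big_nil /= nE natrM mulrCA mulrAC divff ?gt_eqF // mul1r.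
lra.
Qed.

(** The autocorrelation at lag 0 counts the residues coprime to [n]. *)
Lemma sum_noncoprime_flat n p chi eps Ls : flat_character n p chi eps Ls ->
  \sum_(a < n) (1 - (coprime a n)%:R) = - \sum_(ds <- Ls) ds.2 * ds.1%:R :> RR.
Proof.
move=> fl; have := corr_chi fl 0.
rewrite (eq_bigr (fun a : 'I_n => (coprime a n)%:R)); last first.
  by move=> a _; rewrite addn0 -expr2 (chi_sq fl).
rewrite dvdn0 mul1r sumrB sumr_const card_ord => ->.
rewrite opprD addrA subrr add0r; congr (- _).
by apply: eq_bigr => ds _; rewrite dvdn0 mulr1.
Qed.

(** * Estimates for a square-free modulus below the cube of its least prime factor *)

Section Modulus.
Variable n : nat.
Hypotheses (n_odd : Nat.odd n = true) (n_sqf : squarefree n) (n_gt1 : (1 < n)%coq_nat).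
Let p := smallest_prime_factor n.
Hypothesis n_lt : (n < p * p * p)%coq_nat.

Lemma odd_E m : Nat.odd m = odd m.
Proof. by elim: m => // m IH; rewrite Nat.odd_succ -Nat.negb_odd IH. Qed.

Let flat : exists eps Ls, flat_character n p (fun a => IZR (jacobi a n)) eps Ls /\
    (- \sum_(ds <- Ls) ds.2 * ds.1%:R <= 2 * n%:R / p%:R :> RR).
Proof.
apply: jacobi_flat_character => //; first by rewrite -odd_E.
  by apply/ssrnat.ltP.
apply/ssrnat.ltP; move: n_lt; rewrite /p /smallest_prime_factor.
by move: (pdiv n) => m; rewrite !expnS expn0; lia.
Qed.

Lemma smallest_prime_factor_gt1 : (1 < p)%coq_nat.
Proof. by apply/ssrnat.ltP/prime_gt1/pdiv_prime/ssrnat.ltP. Qed.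

Lemma smallest_prime_factor_le : (p <= n)%coq_nat.
Proof. by apply/ssrnat.leP/pdiv_leq/ltnW/ssrnat.ltP. Qed.

Lemma jacobi_period a : jacobi (a + n)%coq_nat n = jacobi a n.
Proof. by have [eps [Ls [fl _]]] := flat; apply: eq_IZR; apply: (chi_per fl). Qed.

Lemma jacobi_square a :
  (IZR (jacobi a n) * IZR (jacobi a n))%coqR = indic (Nat.eqb (Nat.gcd a n) 1).
Proof.
have [eps [Ls [fl _]]] := flat.
by rewrite gcd_coprime indicE -(chi_sq fl a) expr2.
Qed.

Lemma noncoprime_count (R0 : nat) :
  (rsum n (fun a => 1 - indic (Nat.eqb (Nat.gcd (a + R0)%coq_nat n) 1))
   <= 2 * INR n / INR p)%coqR.
Proof.
have [eps [Ls [fl B]]] := flat.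
pose f a : RR := 1 - (coprime a n)%:R.
have fP : periodic n f by move=> a; rewrite /f /coprime gcdnC gcdnDr gcdnC.
set s := rsum n _.
have -> : s = \sum_(a < n) f a.
  rewrite /s rsumE -(sum_periodic_shift R0 fP); apply: eq_bigr => a _.
  by rewrite gcd_coprime indicE.
rewrite (sum_noncoprime_flat fl); apply/RleP; move: B.
by rewrite !INRE.
Qed.

(** [kappa] is tied to [R0] by an equation with explicit quotient [j], because the computation of
    the limit distinguishes the values of [j]. *)
Lemma jacobi_quad_energy (R0 M : nat) :
  (R0 < n)%coq_nat -> (0 < M)%coq_nat -> (M * M <= p)%coq_nat ->
  exists kappa j : nat, (kappa < n)%coq_nat /\ (kappa + 2 * R0 = j * n)%coq_nat /\
  (Rabs (quad_energy n (fun a => IZR (jacobi (a + R0)%coq_nat n)) -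
     INR n * INR n * (5 / 3 - 2 * (INR kappa / INR n) * (1 - INR kappa / INR n)))
   <= INR n * (5 * (2 * INR n / INR p) + 8) +
      36 * (INR n * INR n) * (/ INR M + 3 * (INR M * INR M) / INR p))%coqR.
Proof.
move=> /ssrnat.ltP R0n /ssrnat.ltP M0 /ssrnat.leP Mp; have [eps [Ls [fl B]]] := flat.
have Mp' : (M ^ 2 <= p)%N by rewrite -mulnn.
exists ((3 * n - 2 * R0) %% n)%N, (((3 * n - 2 * R0) %% n + 2 * R0) %/ n)%N.
have n0 : (0 < n)%N by apply: leq_ltn_trans R0n.
split; first by apply/ssrnat.ltP; rewrite ltn_pmod.
split; first by rewrite -[RHS]/(_ * _)%N -[LHS]/(_ + _)%N divnK // dvdn_double_opp.
have := fourth_moment_estimate fl R0n M0 Mp' (erefl _).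
rewrite quad_energyE !INRE; set W := \sum_(a < n) _.
have -> : W = - \sum_(ds <- Ls) ds.2 * ds.1%:R by apply: sum_noncoprime_flat fl.
have lit k : IZR (Z.of_nat k) = k%:R :> RR by rewrite -INR_IZR_INZ INRE.
move=> H; apply/RleP.
rewrite -[IZR 5]/(IZR (Z.of_nat 5)) -[IZR 3]/(IZR (Z.of_nat 3)) -[IZR 2]/(IZR (Z.of_nat 2)).
rewrite -[IZR 8]/(IZR (Z.of_nat 8)) -[IZR 36]/(IZR (Z.of_nat 36)) !lit !RealsE.
apply: le_trans H _.
rewrite lerD // ler_wpM2l // lerD2r.
by rewrite ler_wpM2l.
Qed.

End Modulus.
End JacobiSymbol.

End JacobiMoments.

(** * The perturbed character polynomial *)

Lemma rsum_le N f g : (forall k, (k < N)%nat -> f k <= g k) -> rsum N f <= rsum N g.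
Proof.
  induction N as [|N IH]; intros H; simpl; [lra|].
  apply Rplus_le_compat; auto.
Qed.

Lemma rsum_nonneg N f : (forall k, (k < N)%nat -> 0 <= f k) -> 0 <= rsum N f.
Proof. intros H; rewrite <- (rsum_zero N); now apply rsum_le. Qed.

Lemma rsum_abs N f : Rabs (rsum N f) <= rsum N (fun k => Rabs (f k)).
Proof.
  induction N as [|N IH]; simpl; [rewrite Rabs_R0; lra|].
  eapply Rle_trans; [apply Rabs_triang|]; lra.
Qed.

Lemma rsum_solution N y a b c : (forall k, (k < N)%nat -> 0 <= y k <= 1) ->
  rsum N (fun d => indic (Nat.eqb (a + b) (c + d)) * y d) <= 1.
Proof.
  intros Hy.
  assert (E : forall d, indic (Nat.eqb (a + b) (c + d)) * y d =
     indic (Nat.leb c (a + b)) * (y d * indic (Nat.eqb (a + b - c) d))).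
  { intros d; unfold indic; destruct (Nat.eqb_spec (a + b) (c + d)),
      (Nat.leb_spec c (a + b)), (Nat.eqb_spec (a + b - c) d); try lia; ring. }
  rewrite (rsum_ext _ _ _ (fun d _ => E d)), rsum_scal.
  set (s := rsum N _).
  assert (0 <= s <= 1); [|unfold indic; destruct (Nat.leb c (a + b)); lra].
  unfold s; destruct (Nat.lt_ge_cases (a + b - c) N) as [H|H].
  - rewrite rsum_pick by trivial; auto.
  - rewrite (rsum_ext _ _ (fun _ => 0)), rsum_zero; [lra|].
    intros k Hk; unfold indic; destruct (Nat.eqb_spec (a + b - c) k); [lia|ring].
Qed.

(* Three coordinates of an additive quadruple determine the fourth. *)
Lemma quad_energy_support_bound N y : (forall k, (k < N)%nat -> Rabs (y k) <= 1) ->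
  quad_energy N y <= rsum N (fun k => Rabs (y k)) ^ 3.
Proof.
  intros Hy; set (s := rsum N (fun k => Rabs (y k))).
  apply Rle_trans with (rsum N (fun a => rsum N (fun b => rsum N (fun c =>
     Rabs (y a) * Rabs (y b) * Rabs (y c))))).
  - eapply Rle_trans; [apply Rle_abs|].
    eapply Rle_trans; [apply rsum_abs|]; apply rsum_le; intros a _.
    eapply Rle_trans; [apply rsum_abs|]; apply rsum_le; intros b _.
    eapply Rle_trans; [apply rsum_abs|]; apply rsum_le; intros c _.
    eapply Rle_trans; [apply rsum_abs|].
    rewrite (rsum_ext _ _ (fun d => Rabs (y a) * Rabs (y b) * Rabs (y c) *
       (indic (Nat.eqb (a + b) (c + d)) * Rabs (y d)))).
    + rewrite rsum_scal; rewrite <- Rmult_1_r; apply Rmult_le_compat_l.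
      * repeat apply Rmult_le_pos; apply Rabs_pos.
      * apply rsum_solution; split; [apply Rabs_pos|auto].
    + intros d _; rewrite !Rabs_mult.
      rewrite (Rabs_pos_eq (indic _)) by (unfold indic; destruct Nat.eqb; lra); ring.
  - apply Req_le; transitivity (s * (s * s)); [|ring].
    unfold s; rewrite rsum_prod, rsum_prod; apply rsum_ext; intros a _.
    apply rsum_ext; intros b _.
    rewrite <- rsum_scal; apply rsum_ext; intros c _; ring.
Qed.

(** The maximum of a nonempty list is one of its entries, so an estimate uniform in [V] passes to
    it; nonemptiness excludes the default value 0. *)
Lemma list_max_near l f e : l <> nil -> (forall x, In x l -> Rabs (x - f) < e) ->
  Rabs (Defs.list_max l - f) < e.
Proof.
  induction l as [|x l IH]; intros Hn H; [easy|].
  destruct l as [|y l]; [apply H; now left|].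
  change (Defs.list_max (x :: y :: l)) with (Rmax x (Defs.list_max (y :: l))).
  unfold Rmax; destruct Rle_dec; [apply IH; [easy|intros; apply H; now right]|].
  apply H; now left.
Qed.

Lemma list_min_near l f e : l <> nil -> (forall x, In x l -> Rabs (x - f) < e) ->
  Rabs (list_min l - f) < e.
Proof.
  induction l as [|x l IH]; intros Hn H; [easy|].
  destruct l as [|y l]; [apply H; now left|].
  change (list_min (x :: y :: l)) with (Rmin x (list_min (y :: l))).
  unfold Rmin; destruct Rle_dec; [apply H; now left|].
  apply IH; [easy|intros; apply H; now right].
Qed.

Definition ternary (z : Z) := (z = -1 \/ z = 0 \/ z = 1)%Z.

Lemma tern_vecs_complete v : Forall ternary v -> In v (tern_vecs (length v)).
Proof.
  induction 1 as [|z v Hz _ IH]; simpl; [now left|].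
  apply in_flat_map; exists v; split; [trivial|].
  destruct Hz as [-> |[-> | ->]]; simpl; tauto.
Qed.

Lemma tern_vecs_ternary k v j : In v (tern_vecs k) -> ternary (nth j v 0%Z).
Proof.
  revert v j; induction k as [|k IH]; simpl; intros v j H.
  - destruct H as [<- |[]]; destruct j; unfold ternary; simpl; auto.
  - apply in_flat_map in H; destruct H as [w [Hw H]].
    assert (Hz : exists z, ternary z /\ v = z :: w).
    { destruct H as [<- |[<- |[<- |[]]]];
        [exists (-1)%Z|exists 0%Z|exists 1%Z]; unfold ternary; split; auto. }
    destruct Hz as [z [Hz ->]]; destruct j; simpl; auto.
Qed.

Lemma Vn_nonempty n : Vn n <> nil.
Proof.
  (* The sign +1 at every position not coprime to [n] gives a member of [Vn]. *)
  set (f := fun j => if Nat.eqb (Nat.gcd j n) 1 then 0%Z else 1%Z).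
  set (v := map f (seq 0 n)).
  assert (Hv : In v (Vn n)); [|intros E; rewrite E in Hv; easy].
  apply filter_In; split.
  - replace n with (length v) by (unfold v; now rewrite length_map, length_seq).
    apply tern_vecs_complete, Forall_map, Forall_forall; intros j _.
    unfold f, ternary; destruct Nat.eqb; auto.
  - apply forallb_forall; intros j Hj; apply in_seq in Hj.
    rewrite (nth_indep v 0%Z (f 0%nat)) by (unfold v; rewrite length_map, length_seq; lia).
    unfold v; rewrite map_nth, seq_nth by lia; simpl; unfold f.
    destruct (Nat.eqb (Nat.gcd j n) 1); reflexivity.
Qed.

(** * Rotations and the limit value *)

Definition shift n r : nat := Z.to_nat (Int_part (INR n * r) mod Z.of_nat n)%Z.

Lemma shift_lt n r : (0 < n)%nat -> (shift n r < n)%nat.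
Proof.
  intros Hn; unfold shift.
  pose proof (Z.mod_pos_bound (Int_part (INR n * r)) (Z.of_nat n) ltac:(lia)); lia.
Qed.

Lemma rot_index n r j : (0 < n)%nat ->
  Z.to_nat ((Z.of_nat j + Int_part (INR n * r)) mod Z.of_nat n)%Z = ((j + shift n r) mod n)%nat.
Proof.
  intros Hn; apply Nat2Z.inj.
  pose proof (Z.mod_pos_bound (Int_part (INR n * r)) (Z.of_nat n) ltac:(lia)).
  pose proof (Z.mod_pos_bound (Z.of_nat j + Int_part (INR n * r)) (Z.of_nat n) ltac:(lia)).
  rewrite Z2Nat.id by lia; unfold shift.
  rewrite Nat2Z.inj_mod, Nat2Z.inj_add, Z2Nat.id by lia.
  now rewrite Zplus_mod_idemp_r.
Qed.

(** With [x = kappa/n] and [y = shift/n], the equation [x + 2y = j] leaves [j] in [{0, 1, 2}], and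
    [5/3 - 2x(1-x) = 7/6 + 8(mu - 1/4)^2] where [mu] is the distance from [y] to the nearest
    integer. Up to the rounding of [n r], [y] is [r] modulo 1, and [1 + 1/f(r)] is the same
    expression at the distance from [r] to the nearest integer. *)
Lemma limit_value_near n r kappa j : (2 <= n)%nat -> (kappa < n)%nat ->
  (kappa + 2 * shift n r = j * n)%nat ->
  Rabs (5 / 3 - 2 * (INR kappa / INR n) * (1 - INR kappa / INR n) - (1 + / flim r)) <= 8 / INR n.
Proof.
  intros Hn Hk Hj.
  assert (HN : 2 <= INR n) by (replace 2 with (INR 2) by (simpl; ring); now apply le_INR).
  pose proof (shift_lt n r ltac:(lia)) as Hs.
  set (N := INR n) in *; set (x := INR kappa / N); set (y := INR (shift n r) / N).
  assert (Hx : 0 <= x < 1).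
  { unfold x; pose proof (pos_INR kappa); apply lt_INR in Hk; fold N in Hk; split.
    - apply Rmult_le_pos; [trivial|left; apply Rinv_0_lt_compat; lra].
    - apply Rmult_lt_reg_r with N; [lra|]; unfold Rdiv; rewrite Rmult_assoc, Rinv_l; lra. }
  assert (Hy : 0 <= y < 1).
  { unfold y; pose proof (pos_INR (shift n r)); apply lt_INR in Hs; fold N in Hs; split.
    - apply Rmult_le_pos; [trivial|left; apply Rinv_0_lt_compat; lra].
    - apply Rmult_lt_reg_r with N; [lra|]; unfold Rdiv; rewrite Rmult_assoc, Rinv_l; lra. }
  assert (Hxy : x + 2 * y = INR j).
  { unfold x, y; apply (f_equal INR) in Hj; rewrite plus_INR, !mult_INR in Hj; fold N in Hj.
    simpl (INR 2) in Hj; apply Rmult_eq_reg_r with N; [|lra].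
    replace ((INR kappa / N + 2 * (INR (shift n r) / N)) * N)
      with (INR kappa + 2 * INR (shift n r)) by (field; lra).
    lra. }
  assert (Hj3 : (j < 3)%nat) by (apply INR_lt; simpl; lra).
  (* [t] is the fractional part of [n r] divided by [n]; it is the only discrepancy between [y] and
     [r] modulo 1. *)
  set (t := (N * r - IZR (Int_part (N * r))) / N).
  assert (Ht : 0 <= t /\ t * N < 1).
  { unfold t; destruct (base_Int_part (N * r)); split.
    - apply Rmult_le_pos; [lra|left; apply Rinv_0_lt_compat; lra].
    - unfold Rdiv; rewrite Rmult_assoc, Rinv_l; lra. }
  set (rho := r - IZR (1 - up (/ 2 - r))).
  assert (Hrho : - / 2 < rho <= / 2).
  { unfold rho; rewrite minus_IZR; destruct (archimed (/ 2 - r)); lra. }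
  assert (Hm : exists m : Z, y = rho + IZR m - t).
  { exists (1 - up (/ 2 - r) - Int_part (N * r) / Z.of_nat n)%Z.
    assert (E : INR (shift n r) =
      IZR (Int_part (N * r)) - IZR (Int_part (N * r) / Z.of_nat n) * N).
    { unfold shift; fold N; rewrite INR_IZR_INZ, Z2Nat.id by (apply Z.mod_pos_bound; lia).
      rewrite Z.mod_eq, minus_IZR, mult_IZR, <- INR_IZR_INZ by lia; fold N; ring. }
    unfold y, t, rho; rewrite E, !minus_IZR; field; lra. }
  destruct Hm as [m Hm].
  assert (Ht2 : t < / 2) by nra.
  assert (HNt : t <= / N).
  { apply Rmult_le_reg_r with N; [lra|]; rewrite Rinv_l; lra. }
  assert (Hm01 : (m = 0 \/ m = 1)%Z).
  { assert (-1 < m)%Z by (apply lt_IZR; lra). assert (m < 2)%Z by (apply lt_IZR; lra). lia. }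
  assert (Hf : / flim r = / 6 + 8 * (Rabs rho - / 4) ^ 2).
  { unfold flim, f_base; fold rho; apply Rinv_inv. }
  rewrite Hf; clear Hf.
  assert (Hmu : exists mu, 0 <= mu <= / 2 /\
     5 / 3 - 2 * x * (1 - x) = 7 / 6 + 8 * (mu - / 4) ^ 2 /\ Rabs (mu - Rabs rho) <= t).
  { assert (Hr : Rabs rho = rho /\ 0 <= rho \/ Rabs rho = - rho /\ rho < 0).
    { unfold Rabs; destruct Rcase_abs; lra. }
    (* [j = 0] forces [x = y = 0]; [j = 1] puts [y] in the lower half of the unit interval, and
       [j = 2] in the upper half. *)
    assert (Hcase : (x = 1 - 2 * y \/ (x = 0 /\ y = 0)) \/ x = 2 - 2 * y).
    { destruct j as [|[|[|j]]]; simpl in Hxy; [left; right|left; left|right|lia]; lra. }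
    destruct Hcase as [Hc|Hc].
    - exists y; split; [destruct Hc; lra|]; split.
      + destruct Hc as [-> |[-> ->]]; field.
      + apply Rabs_le; destruct Hm01 as [-> | ->]; destruct Hr as [[-> ?]|[-> ?]];
          destruct Hc; lra.
    - exists (1 - y); split; [lra|]; split.
      + rewrite Hc; field.
      + apply Rabs_le; destruct Hm01 as [-> | ->]; destruct Hr as [[-> ?]|[-> ?]]; lra. }
  destruct Hmu as [mu [Hmu1 [-> Hmu2]]].
  assert (Hr : 0 <= Rabs rho <= / 2) by (split; [apply Rabs_pos|apply Rabs_le; lra]).
  revert Hmu2 Hr; generalize (Rabs rho); intros q Hq1 Hq2.
  replace (7 / 6 + 8 * (mu - / 4) ^ 2 - (1 + (/ 6 + 8 * (q - / 4) ^ 2)))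
    with (8 * ((mu - q) * (mu + q - / 2))) by field.
  rewrite Rabs_mult, Rabs_mult, (Rabs_pos_eq 8) by lra.
  assert (H : Rabs (mu + q - / 2) <= 1) by (apply Rabs_le; lra).
  pose proof (Rabs_pos (mu - q)); pose proof (Rabs_pos (mu + q - / 2)).
  unfold Rdiv; apply Rmult_le_compat_l; [lra|].
  apply Rle_trans with (Rabs (mu - q) * 1); [now apply Rmult_le_compat_l|lra].
Qed.

(** * The merit factor for a fixed modulus and a fixed [V] *)

Section Merit.
Variables (n : nat) (r : R) (v : list Z).
Hypotheses (n_odd : Nat.odd n = true) (n_sqf : squarefree n) (n_gt1 : (1 < n)%nat).
Let p := smallest_prime_factor n.
Hypothesis n_lt : (n < p * p * p)%nat.
Hypothesis v_in : In v (Vn n).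

Let s := shift n r.
Let J a := IZR (jacobi (a + s) n).
Let V a := IZR (nth ((a + s) mod n) v 0%Z).

Lemma gcd_mod_l a : Nat.gcd (a mod n) n = Nat.gcd a n.
Proof. rewrite Nat.gcd_mod by lia; apply Nat.gcd_comm. Qed.

Lemma jacobi_mod a : jacobi (a mod n) n = jacobi a n.
Proof.
  assert (H : forall k b, jacobi (b + k * n) n = jacobi b n).
  { induction k as [|k IH]; intros b; simpl; [now rewrite Nat.add_0_r|].
    replace (b + (n + k * n))%nat with ((b + k * n) + n)%nat by lia.
    rewrite (JacobiMoments.jacobi_period n_odd n_sqf n_gt1 n_lt); apply IH. }
  rewrite (Nat.div_mod_eq a n) at 2.
  rewrite (Nat.mul_comm n), Nat.add_comm; now rewrite H.
Qed.

Lemma V_values a : ternary (nth (a mod n) v 0%Z) /\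
  (nth (a mod n) v 0%Z = 0%Z <-> Nat.gcd a n = 1%nat).
Proof.
  apply filter_In in v_in; destruct v_in as [H1 H2]; split.
  - now apply tern_vecs_ternary with n.
  - unfold Vn_cond in H2; rewrite forallb_forall in H2.
    assert (Ha : (a mod n < n)%nat) by (apply Nat.mod_upper_bound; lia).
    specialize (H2 (a mod n)%nat ltac:(apply in_seq; lia)).
    apply Bool.eqb_prop in H2; rewrite gcd_mod_l in H2.
    rewrite <- Z.eqb_eq, H2; apply Nat.eqb_eq.
Qed.

Lemma J_square a : J a * J a = indic (Nat.eqb (Nat.gcd (a + s) n) 1).
Proof. exact (JacobiMoments.jacobi_square n_odd n_sqf n_gt1 n_lt (a + s)). Qed.

Lemma V_abs a : Rabs (V a) = 1 - indic (Nat.eqb (Nat.gcd (a + s) n) 1).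
Proof.
  unfold V; destruct (V_values (a + s)) as [Ht H0]; unfold indic.
  destruct (Nat.eqb_spec (Nat.gcd (a + s) n) 1) as [E|E].
  - rewrite (proj2 H0 E), Rabs_R0; ring.
  - destruct Ht as [-> |[Hz| ->]]; [|tauto|]; unfold Rabs; destruct Rcase_abs; lra.
Qed.

(** [J] is nonzero exactly where the shifted index is coprime to [n], and [V] exactly where it is
    not. *)
Lemma JV_square a : (J a + V a) ^ 2 = 1.
Proof.
  pose proof (J_square a) as HJ; pose proof (V_abs a) as HV.
  destruct (Nat.eqb (Nat.gcd (a + s) n) 1); unfold indic in *.
  - assert (V a = 0) by (revert HV; unfold Rabs; destruct Rcase_abs; lra). nra.
  - assert (J a = 0) by nra.
    assert (V a * V a = 1).
    { rewrite <- (Rabs_pos_eq (V a * V a)), Rabs_mult, HV by nra; ring. }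
    nra.
Qed.

Lemma merit_JV_eq : merit_JV n r v =
  INR n ^ 2 / (quad_energy n (fun a => J a + V a) - INR n ^ 2).
Proof.
  (* [rot] vanishes beyond [n], so equality of the coefficient functions requires this cutoff. *)
  set (z := fun j => if Nat.ltb j n then J j + V j else 0).
  assert (Hz : forall j, (j < n)%nat -> z j = J j + V j).
  { intros j Hj; unfold z; destruct (Nat.ltb_spec j n); [reflexivity|lia]. }
  unfold merit_JV.
  replace (padd (rot n r (charpoly n)) (rot n r (vpoly n v))) with (fun j => RtoC (z j)).
  - rewrite merit_real.
    replace (energy n z) with (INR n).
    + f_equal; f_equal; unfold quad_energy.
      repeat (apply rsum_ext; intros ? ?); rewrite !Hz by trivial; reflexivity.
    + unfold energy; rewrite (rsum_ext _ _ (fun _ => 1)).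
      * clear; induction n as [|m IH]; [reflexivity|].
        rewrite S_INR; simpl; now rewrite <- IH.
      * intros k Hk; rewrite Hz by trivial; apply JV_square.
  - apply functional_extensionality; intros j; unfold padd, rot, z.
    destruct (Nat.ltb_spec j n) as [Hj|Hj]; [|now rewrite Cplus_0_r].
    rewrite rot_index by lia; fold s.
    assert (Hi : ((j + s) mod n < n)%nat) by (apply Nat.mod_upper_bound; lia).
    unfold charpoly, vpoly; fold (V j).
    destruct (Nat.ltb_spec ((j + s) mod n) n) as [_|]; [|lia].
    rewrite Bool.andb_true_r, RtoC_plus; f_equal.
    rewrite jacobi_mod; fold (J j).
    destruct (Nat.leb_spec 1 ((j + s) mod n)) as [_|H0]; [reflexivity|].
    (* At index 0 [charpoly] has coefficient 0 by definition, while the symbol vanishes there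
       because [gcd(0, n) = n > 1]. *)
    pose proof (J_square j) as HJ; rewrite <- gcd_mod_l in HJ.
    replace ((j + s) mod n)%nat with 0%nat in HJ by lia.
    rewrite Nat.gcd_0_l in HJ; unfold indic in HJ.
    destruct (Nat.eqb_spec n 1); [lia|].
    f_equal; nra.
Qed.

(** Both signs occur because [V] is first added to [J] and then removed from [J + V]. *)
Lemma V_quad_energy c : c = 1 \/ c = -1 ->
  quad_energy n (fun a => c * V a) <= (2 * INR n / INR p) ^ 3.
Proof.
  intros Hc.
  assert (E : forall a, Rabs (c * V a) = 1 - indic (Nat.eqb (Nat.gcd (a + s) n) 1)).
  { intros a; rewrite Rabs_mult, V_abs.
    replace (Rabs c) with 1; [ring|].
    destruct Hc as [-> | ->]; unfold Rabs; destruct Rcase_abs; lra. }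
  eapply Rle_trans; [apply quad_energy_support_bound|].
  - intros k _; rewrite E; unfold indic; destruct Nat.eqb; lra.
  - apply pow_incr; split.
    + apply rsum_nonneg; intros; apply Rabs_pos.
    + rewrite (rsum_ext _ _ _ (fun k _ => E k)).
      exact (JacobiMoments.noncoprime_count n_odd n_sqf n_gt1 n_lt s).
Qed.

(** [K] measures how far [p^3] exceeds [n], and [tau] is the weight in the perturbation inequality.
    In the last error, [26 = 10 + 8 + 8] collects the noncoprime count, the linear remainder and the
    rounding of [n r], each with [1/n <= 1/p] where it applies; [108 = 36 * 3]. *)
Lemma JV_quad_energy_near M K tau :
  (0 < M)%nat -> (M * M <= p)%nat -> 0 < K -> K * INR n <= INR p ^ 3 ->
  0 < tau <= 1 -> (1 + / tau) ^ 3 * (8 / K) <= 1 ->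
  36 / INR M + (26 + 108 * (INR M * INR M)) / INR p <= / 4 ->
  Rabs (quad_energy n (fun a => J a + V a) / INR n ^ 2 - (1 + / flim r)) <=
  120 * tau + (1 + / tau) ^ 3 * (8 / K)
    + (36 / INR M + (26 + 108 * (INR M * INR M)) / INR p).
Proof.
  intros HM HMp HK HKn Htau Hc Herr.
  destruct (JacobiMoments.jacobi_quad_energy n_odd n_sqf n_gt1 n_lt
    (shift_lt n r ltac:(lia)) HM HMp)
    as [kappa [j [Hk [Hj HJ]]]].
  assert (HG := limit_value_near n r kappa j ltac:(lia) Hk Hj).
  assert (Hp1 : (1 < p)%nat) by exact (JacobiMoments.smallest_prime_factor_gt1 n_gt1).
  assert (Hpn : (p <= n)%nat) by exact (JacobiMoments.smallest_prime_factor_le n_gt1).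
  apply lt_INR in Hp1; apply le_INR in Hpn; apply lt_INR in HM; simpl in Hp1, HM.
  fold p s in HJ; fold J in HJ.
  assert (Hf : 0 <= / flim r <= 2 / 3).
  { unfold flim, f_base; rewrite Rinv_inv.
    set (q := Rabs (r - IZR (1 - up (/ 2 - r)))).
    assert (0 <= q <= / 2); [|nra].
    unfold q; split; [apply Rabs_pos|].
    apply Rabs_le; rewrite minus_IZR; destruct (archimed (/ 2 - r)); lra. }
  set (N := INR n) in *; set (P := INR p) in *; set (m := INR M) in *; set (fl := / flim r) in *.
  set (g := 5 / 3 - 2 * (INR kappa / N) * (1 - INR kappa / N)) in *.
  set (err := 36 / m + (26 + 108 * (m * m)) / P) in *.
  set (c := (1 + / tau) ^ 3 * (8 / K)) in *.
  set (EJ := quad_energy n (fun a => IZR (jacobi (a + s) n))) in *.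
  set (E := quad_energy n (fun a => J a + V a)).
  assert (HN2 : 0 < N ^ 2) by nra.
  assert (HNP : / N <= / P) by (apply Rinv_le_contravar; lra).
  assert (HP0 : 0 < / P) by (apply Rinv_0_lt_compat; lra).
  assert (HEJ : Rabs (EJ / N ^ 2 - (1 + fl)) <= err).
  { replace (EJ / N ^ 2 - (1 + fl))
      with ((EJ - N * N * g) * / N ^ 2 + (g - (1 + fl))) by (field; lra).
    eapply Rle_trans; [apply Rabs_triang|].
    rewrite Rabs_mult, (Rabs_pos_eq (/ N ^ 2)) by (left; now apply Rinv_0_lt_compat).
    assert (H : Rabs (EJ - N * N * g) * / N ^ 2 <=
       (N * (5 * (2 * N / P) + 8) + 36 * (N * N) * (/ m + 3 * (m * m) / P)) * / N ^ 2)
      by (apply Rmult_le_compat_r; [left; now apply Rinv_0_lt_compat|exact HJ]).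
    replace ((N * (5 * (2 * N / P) + 8) + 36 * (N * N) * (/ m + 3 * (m * m) / P)) * / N ^ 2)
      with (10 * / P + 8 * / N + 36 * / m + 108 * (m * m) * / P) in H by (field; lra).
    unfold err, Rdiv in *; lra. }
  assert (HEV : forall e, e = 1 \/ e = -1 ->
     (1 + / tau) ^ 3 * quad_energy n (fun a => e * V a) <= c * N ^ 2).
  { intros e He.
    assert (Hle : quad_energy n (fun a => e * V a) <= 8 / K * N ^ 2).
    { eapply Rle_trans; [now apply V_quad_energy|]; fold N P.
      replace ((2 * N / P) ^ 3) with (8 * N ^ 2 * (N * / P ^ 3)) by (field; lra).
      replace (8 / K * N ^ 2) with (8 * N ^ 2 * / K) by (field; lra).
      apply Rmult_le_compat_l; [lra|].
      assert (HP3 : 0 < P ^ 3) by (apply pow_lt; lra).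
      apply Rmult_le_reg_l with K; [trivial|]; rewrite Rinv_r by lra.
      apply Rmult_le_reg_r with (P ^ 3); [trivial|].
      replace (K * (N * / P ^ 3) * P ^ 3) with (K * N) by (field; lra); lra. }
    unfold c; rewrite (Rmult_assoc ((1 + / tau) ^ 3)); apply Rmult_le_compat_l; [|exact Hle].
    apply pow_le; assert (0 < / tau) by (apply Rinv_0_lt_compat; lra); lra. }
  assert (HE1 : E <= (1 + tau) ^ 3 * EJ + c * N ^ 2).
  { unfold E, EJ; eapply Rle_trans; [apply (quad_energy_perturb n J V tau); lra|].
    apply Rplus_le_compat_l; specialize (HEV 1 (or_introl eq_refl)).
    replace (fun a => 1 * V a) with V in HEV; [exact HEV|].
    apply functional_extensionality; intros a; ring. }
  assert (HE2 : EJ <= (1 + tau) ^ 3 * E + c * N ^ 2).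
  (* Writing [J = (J + V) - V] gives the reverse inequality. *)
  { replace EJ with (quad_energy n (fun a => (J a + V a) + -1 * V a)).
    - eapply Rle_trans; [apply (quad_energy_perturb n _ _ tau); lra|].
      apply Rplus_le_compat_l, HEV; now right.
    - unfold EJ; f_equal; apply functional_extensionality; intros a; unfold J; ring. }
  assert (Hc0 : 0 <= c).
  { unfold c; assert (0 < / tau) by (apply Rinv_0_lt_compat; lra).
    apply Rmult_le_pos; [apply pow_le; lra|left; apply Rdiv_lt_0_compat; lra]. }
  set (eJ := EJ / N ^ 2) in *; set (e := E / N ^ 2).
  assert (HEe : E = e * N ^ 2) by (unfold e; field; lra).
  assert (HEJe : EJ = eJ * N ^ 2) by (unfold eJ; field; lra).
  assert (He1 : e <= (1 + tau) ^ 3 * eJ + c).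
  { apply Rmult_le_reg_r with (N ^ 2); [trivial|]; rewrite <- HEe.
    eapply Rle_trans; [exact HE1|]; rewrite HEJe; apply Req_le; ring. }
  assert (He2 : eJ <= (1 + tau) ^ 3 * e + c).
  { apply Rmult_le_reg_r with (N ^ 2); [trivial|]; rewrite <- HEJe.
    eapply Rle_trans; [exact HE2|]; rewrite HEe; apply Req_le; ring. }
  assert (Ht3 : 1 <= (1 + tau) ^ 3 <= 1 + 7 * tau).
  { split; [|]; ring_simplify; nra. }
  apply Rabs_le_between in HEJ.
  assert (He0 : 0 <= e).
  { apply Rmult_le_pos; [apply quad_energy_pos|left; now apply Rinv_0_lt_compat]. }
  apply Rabs_le_between.
  assert (HeJ2 : 0 <= eJ <= 2).
  { split; [|lra].
    apply Rmult_le_pos; [apply quad_energy_pos|left; now apply Rinv_0_lt_compat]. }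
  (* [(1 + tau)^3 <= 8], [eJ <= 2] and [c <= 1] give 17; the perturbation then costs at most
     [7 tau * 17], below [120 tau]. *)
  assert (He17 : e <= 17) by nra.
  split; nra.
Qed.

End Merit.

(** * Passage to the limit *)

Lemma inverse_near e g d : / 6 <= g -> Rabs (e - g) <= d -> d <= / 12 ->
  Rabs (/ e - / g) <= 72 * d.
Proof.
  intros Hg He Hd.
  assert (He' : / 12 <= e) by (apply Rabs_le_between in He; lra).
  replace (/ e - / g) with ((g - e) * (/ e * / g)) by (field; lra).
  rewrite Rabs_mult, Rabs_minus_sym.
  assert (H1 : 0 < / e <= 12).
  { split; [apply Rinv_0_lt_compat; lra|].
    replace 12 with (/ / 12) by field; apply Rinv_le_contravar; lra. }
  assert (H2 : 0 < / g <= 6).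
  { split; [apply Rinv_0_lt_compat; lra|].
    replace 6 with (/ / 6) by field; apply Rinv_le_contravar; lra. }
  rewrite (Rabs_pos_eq (/ e * / g)) by nra.
  pose proof (Rabs_pos (e - g)).
  assert (/ e * / g <= 72) by nra.
  nra.
Qed.

(** [N] and [K] are chosen before [n] and [v], which provides the uniformity required for the
    extrema. *)
Lemma merit_JV_near r eps : 0 < eps -> exists (N : nat) (K : R), 0 < K /\
  forall n v, Nat.odd n = true -> squarefree n -> (1 < n)%nat -> (N <= n)%nat ->
  K * INR n <= INR (smallest_prime_factor n) ^ 3 -> In v (Vn n) ->
  Rabs (merit_JV n r v - flim r) < eps.
Proof.
  intros Heps.
  (* [d <= 1/12] is required by [inverse_near], and [72 d <= eps / 2]. The errors below are
     [120 tau = d/4], [d/4] from [K], [d/8] from [M] and [d/4] from [p], together less than [d]. *)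
  set (d := Rmin (/ 12) (eps / 144)).
  assert (Hd : 0 < d <= / 12 /\ 72 * d < eps).
  { unfold d, Rmin; destruct Rle_dec; lra. }
  set (tau := d / 480).
  assert (Htau : 0 < tau <= 1) by (unfold tau; lra).
  assert (Hti : 0 < / tau) by (apply Rinv_0_lt_compat; lra).
  set (C3 := (1 + / tau) ^ 3).
  assert (HC3 : 0 < C3) by (apply pow_lt; lra).
  (* The summand 2 yields [n < p^3]; the other one makes the contribution of [V] at most [d/4]. *)
  set (K := 2 + 32 * C3 / d).
  assert (HK1 : 0 < C3 / d) by (apply Rdiv_lt_0_compat; lra).
  assert (HK : 2 <= K) by (unfold K; unfold Rdiv in *; nra).
  assert (HcK : C3 * (8 / K) <= d / 4).
  { apply Rmult_le_reg_r with K; [lra|].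
    replace (C3 * (8 / K) * K) with (8 * C3) by (field; lra).
    replace (d / 4 * K) with (d / 2 + 8 * C3) by (unfold K; field; lra). lra. }
  destruct (nfloor_ex (288 / d)) as [M0 [_ HM0]];
    [left; apply Rdiv_lt_0_compat; lra|].
  set (M := S M0).
  assert (HM : 288 / d < INR M) by (unfold M; rewrite S_INR; lra).
  assert (HMd : 36 / INR M <= d / 8).
  { assert (H : 0 < 288 / d) by (apply Rdiv_lt_0_compat; lra).
    apply Rmult_le_reg_r with (INR M); [lra|].
    replace (36 / INR M * INR M) with 36 by (field; lra).
    apply Rle_trans with (d / 8 * (288 / d)); [apply Req_le; field; lra|].
    apply Rmult_le_compat_l; lra. }
  set (Q := 26 + 108 * (INR M * INR M)).
  assert (HQ : 26 <= Q) by (unfold Q; pose proof (pos_INR M); nra).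
  assert (HQd : 0 < Q / d) by (apply Rdiv_lt_0_compat; lra).
  destruct (nfloor_ex ((4 * (Q / d)) ^ 3)) as [N0 [_ HN0]]; [apply pow_le; lra|].
  exists (S N0), K; split; [lra|].
  intros n v Hodd Hsq Hn1 HnN HKn Hv.
  set (p := smallest_prime_factor n) in *.
  assert (Hn : 1 < INR n) by (apply lt_INR in Hn1; exact Hn1).
  assert (Hn3 : (n < p * p * p)%nat).
  { apply INR_lt; rewrite !mult_INR; simpl in HKn; nra. }
  (* [p] is large because [p^3 >= K n >= n], and [n] exceeds the cube of the desired bound. *)
  assert (Hp : 4 * (Q / d) <= INR p).
  { apply Rnot_lt_le; intros Hlt.
    assert (INR p ^ 3 <= (4 * (Q / d)) ^ 3) by (apply pow_incr; split; [apply pos_INR|lra]).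
    apply le_INR in HnN; rewrite S_INR in HnN; nra. }
  assert (HQp : Q / INR p <= d / 4).
  { apply Rmult_le_reg_r with (INR p); [lra|].
    replace (Q / INR p * INR p) with Q by (field; lra).
    apply Rle_trans with (d / 4 * (4 * (Q / d))); [apply Req_le; field; lra|].
    apply Rmult_le_compat_l; lra. }
  assert (HMp : (M * M <= p)%nat).
  { apply INR_le; rewrite mult_INR; apply Rle_trans with (4 * (Q / d)); [|exact Hp].
    assert (Q <= Q / d).
    { apply Rmult_le_reg_r with d; [lra|]; unfold Rdiv; rewrite Rmult_assoc, Rinv_l; nra. }
    unfold Q in *; pose proof (pos_INR M); nra. }
  rewrite (merit_JV_eq n r v Hodd Hsq Hn1 Hn3 Hv).
  pose proof (JV_quad_energy_near n r v Hodd Hsq Hn1 Hn3 Hv M K tau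
    ltac:(unfold M; lia) HMp ltac:(lra) HKn Htau ltac:(fold C3; lra) ltac:(fold Q p; lra)) as H.
  fold C3 Q p in H.
  set (E := quad_energy n _) in *.
  assert (HE : Rabs ((E / INR n ^ 2 - 1) - / flim r) <= d).
  { replace (E / INR n ^ 2 - 1 - / flim r) with (E / INR n ^ 2 - (1 + / flim r)) by ring.
    eapply Rle_trans; [exact H|]; unfold tau; lra. }
  assert (Hf : / 6 <= / flim r).
  { unfold flim, f_base; rewrite Rinv_inv; set (q := Rabs _).
    pose proof (pow2_ge_0 (q - / 4)); lra. }
  pose proof (inverse_near _ _ d Hf HE ltac:(lra)) as HI; rewrite Rinv_inv in HI.
  replace (INR n ^ 2 / (E - INR n ^ 2)) with (/ (E / INR n ^ 2 - 1)); [lra|].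
  assert (Hw : E / INR n ^ 2 - 1 <> 0) by (apply Rabs_le_between in HE; lra).
  assert (HEn : E - INR n ^ 2 = (E / INR n ^ 2 - 1) * INR n ^ 2) by (field; lra).
  rewrite HEn; revert Hw; generalize (E / INR n ^ 2 - 1); intros w Hw.
  field; repeat split; solve [trivial|lra].
Qed.

(** With [x = n^(1/3)/p], the bounds [x < 1] and [K x < 1] give [K x^3 <= 1]; one small ratio thus
    controls [n / p^3]. *)
Lemma cube_root_ratio n p K : (0 < n)%nat -> (0 < p)%nat -> 0 < K ->
  Rabs (Rpower (INR n) (/ 3) / INR p - 0) < Rmin 1 (/ K) -> K * INR n <= INR p ^ 3.
Proof.
  intros Hn Hp HK H; apply lt_INR in Hn, Hp; simpl in Hn, Hp.
  set (c := Rpower (INR n) (/ 3)) in *.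
  assert (Hc : 0 < c) by apply exp_pos.
  assert (Hc3 : INR n = c ^ 3).
  { unfold c; rewrite <- Rpower_pow by apply exp_pos.
    rewrite Rpower_mult; simpl (INR 3); replace (/ 3 * (1 + 1 + 1)) with 1 by field.
    now rewrite Rpower_1. }
  set (x := c / INR p) in *.
  assert (Hx : 0 < x) by (apply Rdiv_lt_0_compat; lra).
  rewrite Rminus_0_r, Rabs_pos_eq in H by lra.
  assert (H1 : x < 1) by (eapply Rlt_le_trans; [exact H|apply Rmin_l]).
  assert (H2 : x < / K) by (eapply Rlt_le_trans; [exact H|apply Rmin_r]).
  assert (H3 : K * x < 1).
  { apply (Rmult_lt_compat_l K) in H2; [|trivial]; rewrite Rinv_r in H2; lra. }
  assert (H4 : K * x ^ 3 <= 1).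
  { replace (K * x ^ 3) with ((K * x) * (x * x)) by ring; nra. }
  rewrite Hc3; replace c with (x * INR p) by (unfold x; field; lra).
  replace (K * (x * INR p) ^ 3) with ((K * x ^ 3) * INR p ^ 3) by ring.
  assert (0 < INR p ^ 3) by (apply pow_lt; lra). nra.
Qed.

Theorem theorem7 (S : nat -> Prop) (r : R)
  (S_infinite : forall N : nat, exists n : nat, S n /\ (N <= n)%nat)
  (S_odd : forall n : nat, S n -> Nat.odd n = true)
  (S_sqfree : forall n : nat, S n -> squarefree n)
  (S_gt1 : forall n : nat, S n -> (1 < n)%nat)
  (S_pn : lim_along S (fun n => Rpower (INR n) (/ 3) / INR (smallest_prime_factor n)) 0) :
  lim_along S (fun n => maxF n r) (flim r) /\ lim_along S (fun n => minF n r) (flim r).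
Proof.
  (* One threshold serves all [V] at once, so both extrema follow from it. *)
  assert (near : forall eps, 0 < eps -> exists N, forall n, S n -> (N <= n)%nat ->
     forall x, In x (map (merit_JV n r) (Vn n)) -> Rabs (x - flim r) < eps).
  { intros eps Heps; destruct (merit_JV_near r eps Heps) as [N1 [K [HK H]]].
    assert (Hmin : 0 < Rmin 1 (/ K)).
    { apply Rmin_glb_lt; [lra|now apply Rinv_0_lt_compat]. }
    destruct (S_pn _ Hmin) as [N2 HN2].
    exists (Nat.max N1 N2); intros n Sn Hn x Hx.
    apply in_map_iff in Hx; destruct Hx as [v [<- Hv]].
    pose proof (S_gt1 n Sn).
    apply H; auto; [lia|].
    apply cube_root_ratio; trivial; [lia| |apply HN2; [trivial|lia]].
    apply Nat.lt_trans with 1%nat; [lia|now apply JacobiMoments.smallest_prime_factor_gt1]. }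
  assert (nonempty : forall n, map (merit_JV n r) (Vn n) <> nil).
  { intros n E; apply map_eq_nil in E; now apply Vn_nonempty in E. }
  split; intros eps Heps; destruct (near eps Heps) as [N HN]; exists N; intros n Sn Hn.
  - apply list_max_near; [apply nonempty|now apply HN].
  - apply list_min_near; [apply nonempty|now apply HN].
Qed.
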